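(* Let $n\ge2$, $p>2$, $0<s<1$, $sp>p-1$, let $\Omega\subset\mathbb{R}^n$ be open and bounded, $\mu\in\mathcal M(\Omega)$, and let $u$ be a SOLA of $(-\Delta_p)^su=\mu$ in $\Omega$, $u=0$ in $\mathbb{R}^n\setminus\Omega$. Let $B_{2R}(x_0)\Subset\Omega$ and assume $\mathbf W^{|\mu|}_{\gamma,p}(x_0,2R)<\infty$. Let $\theta=\theta(n,p,s)\in(0,1/512)$ be the fixed constant described in the context, and put, for $k\ge0$, $$r_k:=\frac R2\theta^k,\qquad E_k:=\Psi_m(u;x_0,r_k),\qquad D_k:=D_\mu(x_0,2r_k),$$ and let $\ell_k(x)=b_k+a_k\cdot(x-x_0)$ be an affine function attaining the infimum defining $E_k$. Then there is a unique pair $(b_*,a_* )\in\mathbb{R}\times\mathbb{R}^n$ such that $$\lim_{r\to0}\frac1r\left(\frac1{|B_r(x_0)|}\int_{B_r(x_0)}|u-b_*-a_*\cdot(x-x_0)|^m\,dx\right)^{1/m}=0.$$ Moreover, $$E_k+D_k+|a_k-a_*|+\frac{|b_k-b_*|}{r_k}\longrightarrow0\qquad(k\to\infty),$$ and, with $C=C(n,p,s)$, $$|a_*|+\sup_{k\ge0}|a_k|+\sum_{k=0}^\infty E_k\le C\left[\mathcal A_m(u;x_0,2R)+\mathbf W^{|\mu|}_{\gamma,p}(x_0,2R)\right].$$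
   Context: Parameters: $m:=p-1$, $\beta:=sp-p+1\in(0,1)$, $\gamma:=\beta/p$. Notation: $B_r(x)$ is the open ball, $(w)_B:=\frac1{|B|}\int_B w\,dx$, $J_p(t):=|t|^{p-2}t$, $\delta u(x,y):=u(x)-u(y)$; $A\Subset\Omega$ means that the closure of $A$ is compact and contained in $\Omega$. $\mathcal M(\Omega)$ is the set of finite signed Radon measures on $\Omega$, extended by zero to $\mathbb{R}^n$; $|\mu|$ is the total variation. Spaces: $W^{s,p}(U)$ is the usual fractional Sobolev space with seminorm $[w]^p_{W^{s,p}(U)}:=\iint_{U\times U}\frac{|w(x)-w(y)|^p}{|x-y|^{n+sp}}\,dx\,dy$; $W^{s,p}_0(\Omega)$ is the closure of $C_c^\infty(\Omega)$ in $W^{s,p}(\mathbb{R}^n)$; $X^{s,p}_0(\Omega):=\{w\in W^{s,p}(\mathbb{R}^n): w=0\text{ a.e. in }\mathbb{R}^n\setminus\Omega\}$. Energy weak solution: for $f\in (W^{s,p}_0(\Omega))'$, an energy weak solution of $(-\Delta_p)^su=f$ in $\Omega$, $u=0$ in $\mathbb{R}^n\setminus\Omega$, is $u\in X_0^{s,p}(\Omega)$ with $\iint_{\mathbb{R}^n\times\mathbb{R}^n}\frac{J_p(\delta u(x,y))\,\delta\varphi(x,y)}{|x-y|^{n+sp}}\,dx\,dy=\langle f,\varphi\rangle$ for every $\varphi\in C_c^\infty(\Omega)$. SOLA: let $\overline q:=\min\{\frac{n(p-1)}{n-s},p\}$. A function $u$, equal to zero a.e. outside $\Omega$, is a SOLA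 of the problem with datum $\mu$ if (i) for some $h\in(0,s)$ and $q\in[m,\overline q)$ one has $u\in W^{h,q}(\Omega)$, and $\iint_{\mathbb{R}^n\times\mathbb{R}^n}\frac{J_p(\delta u)\,\delta\varphi}{|x-y|^{n+sp}}\,dx\,dy=\int_\Omega\varphi\,d\mu$ for every $\varphi\in C_c^\infty(\Omega)$; and (ii) there are $\mu_j\in C_c^\infty(\mathbb{R}^n)$ and energy weak solutions $u_j\in W^{s,p}(\mathbb{R}^n)$ of $(-\Delta_p)^su_j=\mu_j$ in $\Omega$, $u_j=0$ in $\mathbb{R}^n\setminus\Omega$, such that $u_j\to u$ a.e. in $\mathbb{R}^n$ and locally in $L^q(\mathbb{R}^n)$, where $\mu_j$ converge weakly to $\mu$ in the sense of measures in $\Omega$ and $\limsup_{j\to\infty}|\mu_j|(B)\le|\mu|(\overline B)$ for every ball $B\subset\mathbb{R}^n$. Quantities: $\mathrm{Tail}_{m,sp}(w;x_0,R):=\left(R^{sp}\int_{\mathbb{R}^n\setminus B_R(x_0)}\frac{|w(y)|^m}{|y-x_0|^{n+sp}}\,dy\right)^{1/m}$; $$\mathcal A_m(u;x_0,R):=\frac1R\left(\frac1{|B_R(x_0)|}\int_{B_R(x_0)}|u-(u)_{B_R(x_0)}|^m\,dx\right)^{1/m}+\frac1R\,\mathrm{Tail}_{m,sp}\bigl(u-(u)_{B_R(x_0)};x_0,R\bigr);$$ with $\ell_{a,b}(y)=b+a\cdot(y-x_0)$, $$\Psi_m(u;x_0,r):=\inf_{a\in\mathbb{R}^n,\,b\in\mathbb{R}}\left[\frac1r\left(\frac1{|B_r(x_0)|}\int_{B_r(x_0)}|u-\ell_{a,b}|^m\,dx\right)^{1/m}+\frac1r\,\mathrm{Tail}_{m,sp}(u-\ell_{a,b};x_0,r)\right]$$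 (the infimum is attained for $u\in L^m_{\mathrm{loc}}(\mathbb{R}^n)$ with $\int_{\mathbb{R}^n}|u(y)|^m(1+|y|)^{-n-sp}dy<\infty$, in particular for every SOLA); $D_\mu(x_0,r):=\left(\frac{|\mu|(B_r(x_0))}{r^{n-\beta}}\right)^{1/(p-1)}$; $\mathbf W^{|\mu|}_{\gamma,p}(x_0,R):=\int_0^R D_\mu(x_0,\rho)\frac{d\rho}{\rho}$. The constant $\theta$: $\theta\in(0,1/512)$ and a constant $C_0\ge1$, both depending only on $n,p,s$, are fixed so that every SOLA $u$ (for any bounded open $\Omega$ and any datum $\mu\in\mathcal M(\Omega)$) satisfies $\Psi_m(u;x_0,\theta r)\le\frac12\Psi_m(u;x_0,r)+C_0D_\mu(x_0,2r)$ whenever $B_{2r}(x_0)\Subset\Omega$; such constants exist. *)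

(* Defs.v *)
From HB Require Import structures.
From mathcomp Require Import all_boot all_order all_algebra.
From mathcomp Require Import all_classical all_reals all_analysis.
From mathcomp Require Import measurable_realfun.

Set Implicit Arguments.
Unset Strict Implicit.
Unset Printing Implicit Defensive.

Import Order.TTheory GRing.Theory Num.Theory.
Import numFieldNormedType.Exports.

Local Open Scope classical_set_scope.
Local Open Scope ring_scope.

(* The sigma-algebra put on 'rV[R]_n is generated by the coordinate projections;
   it is the Borel one (see open_rV_measurable). *)
Definition rV_coord (R : realType) (n : nat) (i : 'I_n) (x : 'rV[R]_n) : R :=
  x 0 i.

Section rV_measurable.
Context (R : realType) (n : nat).
Let S := g_sigma_preimage (@rV_coord R n).

Let rV_set0 : S set0. Proof. exact: sigma_algebra0. Qed.
Let rV_setC A : S A -> S (~` A). Proof. exact: sigma_algebraC. Qed.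
Let rV_bigcup (F : (set 'rV[R]_n)^nat) :
  (forall i, S (F i)) -> S (\bigcup_i F i).
Proof. exact: sigma_algebra_bigcup. Qed.

HB.instance Definition _ := @isMeasurable.Build default_measure_display
  'rV[R]_n S rV_set0 rV_setC rV_bigcup.
End rV_measurable.

Lemma measurable_rV_coord (R : realType) (n : nat) (i : 'I_n) :
  measurable_fun [set: 'rV[R]_n] (@rV_coord R n i).
Proof.
move=> _ Y mY; rewrite setTI; apply: sub_sigma_algebra => /=.
rewrite -bigcup_seq/=; exists i => /=; first by rewrite mem_index_enum.
by exists Y => //; rewrite setTI.
Qed.

Lemma measurable_rV d (T : measurableType d) (R : realType) (n : nat)
    (f : T -> 'rV[R]_n) :
  (forall i, measurable_fun [set: T] (fun x => f x 0 i)) ->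
  measurable_fun [set: T] f.
Proof.
move=> mf.
suff S : g_sigma_preimage (fun i => @rV_coord R n i \o f) `<=` measurable.
  by move=> _ A mA; apply: S; rewrite g_sigma_preimage_comp; exists A.
apply: smallest_sub; first exact: sigma_algebra_measurable.
case: n => [|n] in f mf *; first by rewrite big_ord0.
rewrite -bigcup_mkord_ord; apply: bigcup_sub => i Ii.
by move=> A [B mB <-]; exact: mf.
Qed.

Lemma open_rV_measurable (R : realType) (n : nat) (A : set 'rV[R]_n) :
  open A -> measurable A.
Proof.
move=> oA.
pose B (z : 'rV[rat]_n * nat) : set 'rV[R]_n :=
  \bigcap_(i in [set: 'I_n])
    (@rV_coord R n i @^-1` ball (ratr (z.1 0 i) : R) z.2.+1%:R^-1).
have mB z : measurable (B z).
  apply: fin_bigcap_measurable; first exact: finite_finset.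
  move=> i _; rewrite -[X in measurable X]setTI.
  by apply: measurable_rV_coord => //; apply: open_measurable; exact: ball_open.
pose F z := if `[< B z `<=` A >] then B z else set0.
have -> : A = \bigcup_z F z.
  apply/seteqP; split=> [x Ax|x [z _]]; last first.
    by rewrite /F; case: asboolP => // zA; exact: zA.
  have /nbhs_ballP[e /= e0 eA] : nbhs x A by exact: open_nbhs_nbhs.
  have [k] : exists k, 0 + k.+1%:R^-1 < e / 2 :> R.
    by apply: ltr_add_invr; exact: divr_gt0.
  rewrite add0r => ke.
  have /choice[q qx] (i : 'I_n) :
      exists q : rat, `|ratr q - x 0 i| < k.+1%:R^-1.
    have [|q] := @rat_in_itvoo R (x 0 i - k.+1%:R^-1) (x 0 i + k.+1%:R^-1).
      by rewrite ltrD2l gt0_cp// invr_gt0.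
    by rewrite in_itv/= -ltr_distl => qx; exists q.
  exists (\row_i q i, k) => //; rewrite /F; case: asboolP => [_ i _|nA].
    by rewrite /rV_coord /ball/= mxE; exact: qx.
  exfalso; apply: nA => y /= By; apply: eA; split=> // i j.
  rewrite !(ord1 i) /ball/= (le_lt_trans (ler_distD (ratr (q j)) _ _))//.
  rewrite [e]splitr ltrD//; first by rewrite distrC (lt_trans (qx j)).
  by have /= := By j Logic.I; rewrite /rV_coord /ball/= mxE => /lt_trans; exact.
apply: countable_bigcupT_measurable => // z; rewrite /F.
by case: ifP.
Qed.

Definition rV_cons (R : realType) (n : nat) (z : R * 'rV[R]_n) : 'rV[R]_n.+1 :=
  \row_i oapp (fun j => z.2 0 j) z.1 (unlift ord0 i).

Definition rV_uncons (R : realType) (n : nat) (v : 'rV[R]_n.+1) :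
  R * 'rV[R]_n := (v 0 0, \row_j v 0 (lift ord0 j)).

Lemma rV_consK (R : realType) (n : nat) : cancel (@rV_cons R n) (@rV_uncons R n).
Proof.
move=> [x v]; rewrite /rV_uncons /rV_cons mxE unlift_none/=; congr pair.
by apply/rowP => j; rewrite !mxE liftK.
Qed.

Lemma measurable_rV_cons (R : realType) (n : nat) :
  measurable_fun [set: measurableTypeR R * 'rV[R]_n] (@rV_cons R n).
Proof.
apply: measurable_rV => i; under eq_fun do rewrite mxE.
case: unliftP => [j _|_] /=; last exact: measurable_fst.
exact: measurableT_comp (@measurable_rV_coord R n j) measurable_snd.
Qed.

Lemma measurable_rV_uncons (R : realType) (n : nat) :
  measurable_fun [set: 'rV[R]_n.+1]
    (@rV_uncons R n : _ -> measurableTypeR R * 'rV[R]_n).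
Proof.
apply/measurable_fun_pairP; split; first exact: measurable_rV_coord.
apply: measurable_rV => i; under eq_fun do rewrite mxE.
exact: measurable_rV_coord.
Qed.

Section leb_step.
Local Open Scope ereal_scope.
Context (R : realType) (n : nat)
  (lam : {sigma_finite_measure set (measurableTypeR R) -> \bar R})
  (mu : {sigma_finite_measure set 'rV[R]_n -> \bar R}).

Definition leb_step : set 'rV[R]_n.+1 -> \bar R :=
  pushforward (lam \x mu) (@rV_cons R n).

Let mcons : measurable_fun [set: measurableTypeR R * 'rV[R]_n] (@rV_cons R n) :=
  @measurable_rV_cons R n.

Let leb_step0 : leb_step set0 = 0.
Proof. exact: measure0. Qed.

Let leb_step_ge0 A : 0 <= leb_step A.
Proof. exact: measure_ge0. Qed.

Let leb_step_sigma_additive : semi_sigma_additive leb_step.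
Proof. exact: measure_semi_sigma_additive. Qed.

HB.instance Definition _ := isMeasure.Build _ _ _ leb_step
  leb_step0 leb_step_ge0 leb_step_sigma_additive.

Let leb_step_sigma_finite : sigma_finite setT leb_step.
Proof.
have /sigma_finiteP[F [FT ndF Foo]] := sigma_finiteT lam.
have /sigma_finiteP[G [GT ndG Goo]] := sigma_finiteT mu.
exists (fun k => @rV_uncons R n @^-1` (F k `*` G k)).
  rewrite -preimage_bigcup.
  suff <- : [set: R * 'rV[R]_n] = \bigcup_k (F k `*` G k) by rewrite preimage_setT.
  rewrite -setXTT FT GT predeqE => -[x y]; split.
    move=> [/= [k _ Fkx] [l _ Gly]]; exists (maxn k l) => //; split.
    - by move: x Fkx; exact/subsetPset/ndF/leq_maxl.
    - by move: y Gly; exact/subsetPset/ndG/leq_maxr.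
  by move=> [k _ []/= ? ?]; split; exists k.
move=> k; have [mFk Fkoo] := Foo k; have [mGk Gkoo] := Goo k; split.
  rewrite -[X in measurable X]setTI; apply: measurable_rV_uncons => //.
  exact: measurableX.
rewrite /leb_step /pushforward -comp_preimage.
rewrite (_ : _ \o _ = id) ?preimage_id; last first.
  by apply/funext => z /=; rewrite rV_consK.
by rewrite product_measure1E// lte_mul_pinfty// ge0_fin_numE.
Qed.

HB.instance Definition _ :=
  Measure_isSigmaFinite.Build _ _ _ leb_step leb_step_sigma_finite.

End leb_step.

Fixpoint leb (R : realType) (n : nat) :
    {sigma_finite_measure set 'rV[R]_n -> \bar R} :=
  match n with
  | 0 => \d_(0 : 'rV[R]_0)
  | k.+1 => leb_step lebesgue_measure (leb R k)
  end.

Lemma measurable_rV_box (R : realType) (n : nat) (a b : 'rV[R]_n) :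
  measurable [set x : 'rV[R]_n | forall i, a 0 i < x 0 i <= b 0 i].
Proof.
have -> : [set x : 'rV[R]_n | forall i, a 0 i < x 0 i <= b 0 i] =
    \bigcap_(i in [set: 'I_n]) (@rV_coord R n i @^-1` `]a 0 i, b 0 i]).
  apply/seteqP; split=> x /= xab i; last first.
    by have := xab i Logic.I; rewrite /= in_itv.
  by move=> _; rewrite /= in_itv; exact: xab.
apply: fin_bigcap_measurable; first exact: finite_finset.
move=> i _; rewrite -[X in measurable X]setTI.
by apply: measurable_rV_coord => //; exact: measurable_itv.
Qed.

Lemma leb_box (R : realType) (n : nat) (a b : 'rV[R]_n) :
  (forall i, a 0 i <= b 0 i) ->
  leb R n [set x | forall i, a 0 i < x 0 i <= b 0 i] =
  (\prod_i (b 0 i - a 0 i))%:E.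
Proof.
elim: n a b => [|n IH] a b ab.
  by rewrite big_ord0 /= diracE mem_set//=; case.
rewrite big_ord_recl EFinM.
pose a' := (rV_uncons a).2; pose b' := (rV_uncons b).2.
rewrite /= /leb_step /pushforward.
set A := _ @^-1` _.
have -> : A = `]a 0 0, b 0 0]%classic `*`
    [set x : 'rV[R]_n | forall i, a' 0 i < x 0 i <= b' 0 i].
  apply/seteqP; split=> [[x v]|[x v] [/= x0 xv]]; rewrite /A /rV_cons /=.
    move=> H; split=> /=.
      by have := H 0; rewrite mxE unlift_none in_itv.
    by move=> i; have := H (lift ord0 i); rewrite !mxE liftK.
  move=> i; rewrite mxE; case: unliftP => [j ->|->] /=.
    by have := xv j; rewrite !mxE.
  by move: x0; rewrite in_itv.
rewrite product_measure1E//; last exact: measurable_rV_box.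
rewrite /= lebesgue_measure_itv /= lte_fin IH; last first.
  by move=> i; rewrite !mxE.
congr (_ * _)%E; last by under eq_bigr do rewrite !mxE.
case: ltP => // ba; rewrite (_ : b 0 0 = a 0 0) ?subrr//.
by apply/eqP; rewrite eq_le ba ab.
Qed.

(* The library topology on 'rV[R]_n is that of the sup norm; balls and lengths
   below are Euclidean. *)
Definition dot (R : realType) (n : nat) (x y : 'rV[R]_n) : R :=
  \sum_i x 0 i * y 0 i.

Definition enorm (R : realType) (n : nat) (x : 'rV[R]_n) : R :=
  Num.sqrt (dot x x).

Definition eball (R : realType) (n : nat) (x : 'rV[R]_n) (r : R) :
  set 'rV[R]_n := [set y | enorm (y - x) < r].

Definition compactly_contained (T : topologicalType) (A U : set T) : Prop :=
  compact (closure A) /\ closure A `<=` U.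

Definition support_set (T : Type) (R : realType) (f : T -> R) : set T :=
  [set x | f x != 0].

Fixpoint class_C (R : realType) (n k : nat) (f : 'rV[R]_n -> R) : Prop :=
  match k with
  | 0 => continuous f
  | k.+1 => continuous f /\ forall i : 'I_n,
      (forall x, derivable f x (delta_mx 0 i)) /\
      class_C k (fun x => 'D_(delta_mx 0 i) f x)
  end.

Definition Cc (R : realType) (n : nat) (U : set 'rV[R]_n)
    (f : 'rV[R]_n -> R) : Prop :=
  continuous f /\ compactly_contained (support_set f) U.

Definition Cc_smooth (R : realType) (n : nat) (U : set 'rV[R]_n)
    (f : 'rV[R]_n -> R) : Prop :=
  (forall k, class_C k f) /\ compactly_contained (support_set f) U.

Section signed_measures.
Context d (T : measurableType d) (R : realType).
Variable nu : {charge set T -> \bar R}.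

Lemma hahn_sets_ex : exists PN, hahn_decomposition nu PN.1 PN.2.
Proof. by have [P [N PN]] := Hahn_decomposition nu; exists (P, N). Qed.

(* The Jordan decomposition does not depend on the chosen Hahn decomposition:
   see Hahn_decomposition_uniq. *)
Let nuPN := svalP (cid hahn_sets_ex).

Definition total_variation : set T -> \bar R := charge_variation nuPN.

Definition charge_integral (D : set T) (f : T -> R) : \bar R :=
  (\int[jordan_pos nuPN]_(x in D) (f x)%:E -
   \int[jordan_neg nuPN]_(x in D) (f x)%:E)%E.

End signed_measures.

(* A {charge set _ -> \bar R} is finite-valued, and every finite Borel measure
   on R^n is Radon. *)
Definition extended_by_zero (R : realType) (n : nat) (U : set 'rV[R]_n)
    (mu : {charge set 'rV[R]_n -> \bar R}) : Prop :=
  forall A, measurable A -> mu A = mu (A `&` U).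

(* x / 0 = 0 and 0 `^ t = 0 for t != 0, so the integrands of gagliardo and of
   the weak formulation are 0 on the (null) diagonal. *)
Definition gagliardo (R : realType) (n : nat) (s p : R) (U : set 'rV[R]_n)
    (w : 'rV[R]_n -> R) : \bar R :=
  (\int[leb R n \x leb R n]_(z in U `*` U)
     (`|w z.1 - w z.2| `^ p / enorm (z.1 - z.2) `^ (n%:R + s * p))%:E)%E.

Definition in_W (R : realType) (n : nat) (s p : R) (U : set 'rV[R]_n)
    (w : 'rV[R]_n -> R) : Prop :=
  [/\ measurable_fun U w,
      (\int[leb R n]_(x in U) (`|w x| `^ p)%:E < +oo)%E &
      (gagliardo s p U w < +oo)%E].

Definition zero_outside (R : realType) (n : nat) (U : set 'rV[R]_n)
    (w : 'rV[R]_n -> R) : Prop :=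
  {ae leb R n, forall x, ~ U x -> w x = 0}.

Definition in_X0 (R : realType) (n : nat) (s p : R) (U : set 'rV[R]_n)
    (w : 'rV[R]_n -> R) : Prop :=
  in_W s p setT w /\ zero_outside U w.

Definition Jp (R : realType) (p t : R) : R := `|t| `^ (p - 2) * t.

Definition pairing_density (R : realType) (n : nat) (s p : R)
    (u phi : 'rV[R]_n -> R) (z : 'rV[R]_n * 'rV[R]_n) : R :=
  Jp p (u z.1 - u z.2) * (phi z.1 - phi z.2) /
  enorm (z.1 - z.2) `^ (n%:R + s * p).

Definition weak_solution (R : realType) (n : nat) (s p : R) (U : set 'rV[R]_n)
    (f : ('rV[R]_n -> R) -> \bar R) (u : 'rV[R]_n -> R) : Prop :=
  forall phi, Cc_smooth U phi ->
    (leb R n \x leb R n)%E.-integrable setT (EFin \o pairing_density s p u phi) /\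
    (\int[leb R n \x leb R n]_z (pairing_density s p u phi z)%:E)%E = f phi.

(* A datum g in C_c^oo acts on test functions by integration. *)
Definition energy_solution (R : realType) (n : nat) (s p : R)
    (U : set 'rV[R]_n) (g u : 'rV[R]_n -> R) : Prop :=
  in_X0 s p U u /\
  weak_solution s p U
    (fun phi => \int[leb R n]_(x in U) (g x * phi x)%:E)%E u.

Definition qbar (R : realType) (n : nat) (s p : R) : R :=
  Num.min (n%:R * (p - 1) / (n%:R - s)) p.

Definition is_SOLA (R : realType) (n : nat) (s p : R) (U : set 'rV[R]_n)
    (mu : {charge set 'rV[R]_n -> \bar R}) (u : 'rV[R]_n -> R) : Prop :=
  [/\ measurable_fun setT u,
      zero_outside U u &
      exists h q : R,
        [/\ 0 < h < s, p - 1 <= q < qbar n s p, in_W h q U u,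
            weak_solution s p U (charge_integral mu U) u &
            exists mu_ u_ : nat -> 'rV[R]_n -> R,
              [/\ forall j, Cc_smooth setT (mu_ j) /\
                            energy_solution s p U (mu_ j) (u_ j),
                  {ae leb R n, forall x, u_ j x @[j --> \oo] --> u x},
                  forall K : set 'rV[R]_n, compact K ->
                    (\int[leb R n]_(x in K) (`|u_ j x - u x| `^ q)%:E)%E
                      @[j --> \oo] --> 0%E,
                  forall phi, Cc U phi ->
                    (\int[leb R n]_(x in U) (phi x * mu_ j x)%:E)%E
                      @[j --> \oo] --> charge_integral mu U phi &
                  forall (c : 'rV[R]_n) (r : R), 0 < r ->
                    (limn_esup (fun j =>
                       \int[leb R n]_(x in eball c r) `|mu_ j x|%:E) <=
                     total_variation mu (closure (eball c r)))%E]]].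

Definition Lmean (R : realType) (n : nat) (m : R) (w : 'rV[R]_n -> R)
    (B : set 'rV[R]_n) : \bar R :=
  (((fine (leb R n B))^-1%:E * \int[leb R n]_(x in B) (`|w x| `^ m)%:E)
     `^ m^-1)%E.

Definition mean (R : realType) (n : nat) (w : 'rV[R]_n -> R)
    (B : set 'rV[R]_n) : R :=
  (fine (leb R n B))^-1 * \int[leb R n]_(x in B) w x.

(* Below, t stands for the product s * p. *)
Definition Tail (R : realType) (n : nat) (m t : R) (w : 'rV[R]_n -> R)
    (x0 : 'rV[R]_n) (r : R) : \bar R :=
  (((r `^ t)%:E * \int[leb R n]_(y in ~` eball x0 r)
      (`|w y| `^ m / enorm (y - x0) `^ (n%:R + t))%:E) `^ m^-1)%E.

Definition excess (R : realType) (n : nat) (m t : R) (w : 'rV[R]_n -> R)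
    (x0 : 'rV[R]_n) (r : R) : \bar R :=
  (r^-1%:E * Lmean m w (eball x0 r) + r^-1%:E * Tail m t w x0 r)%E.

Definition A_m (R : realType) (n : nat) (m t : R) (u : 'rV[R]_n -> R)
    (x0 : 'rV[R]_n) (r : R) : \bar R :=
  excess m t (fun x => u x - mean u (eball x0 r)) x0 r.

Definition affine (R : realType) (n : nat) (x0 a : 'rV[R]_n) (b : R)
    (y : 'rV[R]_n) : R := b + dot a (y - x0).

Definition affine_excess (R : realType) (n : nat) (m t : R)
    (u : 'rV[R]_n -> R) (x0 : 'rV[R]_n) (r : R) (a : 'rV[R]_n) (b : R) :
    \bar R :=
  excess m t (fun x => u x - affine x0 a b x) x0 r.

Definition Psi (R : realType) (n : nat) (m t : R) (u : 'rV[R]_n -> R)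
    (x0 : 'rV[R]_n) (r : R) : \bar R :=
  ereal_inf [set affine_excess m t u x0 r ab.1 ab.2 | ab in setT].

Definition D_mu (R : realType) (n : nat) (s p : R)
    (mu : {charge set 'rV[R]_n -> \bar R}) (x0 : 'rV[R]_n) (r : R) : \bar R :=
  ((total_variation mu (eball x0 r) *
    (r `^ (n%:R - (s * p - p + 1)))^-1%:E) `^ (p - 1)^-1)%E.

(* n - (s * p - p + 1) = n - gamma * p with gamma = (s * p - p + 1) / p: this is
   the Wolff potential W_{gamma,p} of the total variation of mu. *)
Definition wolff (R : realType) (n : nat) (s p : R)
    (mu : {charge set 'rV[R]_n -> \bar R}) (x0 : 'rV[R]_n) (r : R) : \bar R :=
  (\int[lebesgue_measure]_(rho in `]0%R, r]) (D_mu s p mu x0 rho * rho^-1%:E))%E.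

Definition affine_limit (R : realType) (n : nat) (m : R) (u : 'rV[R]_n -> R)
    (x0 : 'rV[R]_n) (ba : R * 'rV[R]_n) : Prop :=
  (r^-1%:E * Lmean m (fun x => (u x - affine x0 ba.2 ba.1 x)%R) (eball x0 r))%E
    @[r --> (0 : R)^'+] --> 0%E.

Definition excess_decay (R : realType) (n : nat) (s p theta C0 : R) : Prop :=
  forall (U : set 'rV[R]_n) (mu : {charge set 'rV[R]_n -> \bar R})
    (u : 'rV[R]_n -> R) (x0 : 'rV[R]_n) (r : R),
    open U -> bounded_set U -> extended_by_zero U mu -> is_SOLA s p U mu u ->
    0 < r -> compactly_contained (eball x0 (2 * r)) U ->
    (Psi (p - 1) (s * p) u x0 (theta * r) <=
     2^-1%:E * Psi (p - 1) (s * p) u x0 r + C0%:E * D_mu s p mu x0 (2 * r))%E.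

(* Main.v *)
Require Import Defs.
From mathcomp Require Import all_boot all_order all_algebra.
From mathcomp Require Import all_classical all_reals all_analysis.
From mathcomp Require Import measurable_realfun ring lra.

Set Implicit Arguments.
Unset Strict Implicit.

Import Order.TTheory GRing.Theory Num.Theory.
Import numFieldNormedType.Exports.

Local Open Scope classical_set_scope.
Local Open Scope ring_scope.

(* Two affine functions that are both close to u on B_r, in the averaged L^m
   sense, are close to each other, with a constant depending only on n and m.
   The decay of the excess sums to sum_k E_k <= 2 (E_0 + C0 sum_k D_k), and
   sum_k D_k is up to a constant a lower Riemann sum of the Wolff potential.
   Comparing l_k with l_{k+1} on B_{r_{k+1}} gives
   |a_k - a_{k+1}| + |b_k - b_{k+1}| / r_k <= C (E_k + E_{k+1}), so both
   sequences converge, with error controlled by the tail of the series.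
   Finally E_0 and |a_0| are estimated by taking the constant (u)_{B_{2R}} as a
   competitor. *)

(** The obstacle in comparing affine functions is cancellation: on a ball, b and a·(x - x0) may
    offset each other. The comparison is therefore made on a small cube placed in an orthant where
    they cannot, and slopes are naturally measured by the l1 norm, which dominates the Euclidean
    one.

    The radii r_k start at R/2 so that the intervals (2r_k, 4r_k], on which D_k is compared with the
    Wolff integrand, lie in (0, 2R]; they are disjoint because theta is at most 1/2.

    The increments of b_k carry the weight r_k. As r_k decreases, the remaining error is r_k times
    the tail of a convergent series, which is exactly what makes |b_k - b_*| / r_k tend to 0. A
    radius between r_{k+1} and r_k costs a volume ratio depending on theta only.

    The bounds are proved with constants built from n, p, s, theta and C0 alone. Excesses are
    extended reals; E_k is finite because u lies in L^m of the whole space. *)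

Definition l1norm (R : realType) (n : nat) (a : 'rV[R]_n) : R :=
  \sum_i `|a 0 i|.

(** * Coordinate cubes, Euclidean balls and their volumes *)

Section Euclidean_balls.
Context (R : realType) (n : nat).
Implicit Types (x y a : 'rV[R]_n) (r : R).

Lemma l1norm_ge0 a : 0 <= l1norm a.
Proof. exact: sumr_ge0. Qed.

Lemma l1normN a : l1norm (- a) = l1norm a.
Proof. by apply: eq_bigr => i _; rewrite mxE normrN. Qed.

Lemma ler_l1normD x y : l1norm (x + y) <= l1norm x + l1norm y.
Proof.
rewrite /l1norm -big_split; apply: ler_sum => i _.
by rewrite mxE ler_normD.
Qed.

Lemma l1norm_eq0 a : l1norm a = 0 -> a = 0.
Proof.
move=> a0; apply/rowP => i; rewrite mxE; apply/eqP; rewrite -normr_eq0.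
by apply/eqP/(psumr_eq0P _ a0).
Qed.

Lemma dot_ge0 x : 0 <= dot x x.
Proof. by apply: sumr_ge0 => i _; rewrite -expr2 sqr_ge0. Qed.

Lemma enorm_ge0 x : 0 <= enorm x.
Proof. exact: sqrtr_ge0. Qed.

Lemma ler_coord_enorm x i : `|x 0 i| <= enorm x.
Proof.
rewrite /enorm -sqrtr_sqr ler_sqrt ?dot_ge0// /dot (bigD1 i)//= -expr2 lerDl.
by apply: sumr_ge0 => j _; rewrite -expr2 sqr_ge0.
Qed.

Lemma enorm_le_l1norm x : enorm x <= l1norm x.
Proof.
rewrite -(ger0_norm (l1norm_ge0 x)) -sqrtr_sqr ler_sqrt ?sqr_ge0//.
rewrite expr2 /l1norm mulr_suml; apply: ler_sum => i _.
rewrite (le_trans (ler_norm _))// normrM ler_wpM2l//.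
by rewrite (bigD1 i)//= lerDl sumr_ge0.
Qed.

Lemma ler_dot_l1norm a x : `|dot a x| <= l1norm a * enorm x.
Proof.
rewrite (le_trans (ler_norm_sum _ _ _))// mulr_suml; apply: ler_sum => i _.
by rewrite normrM ler_wpM2l// ler_coord_enorm.
Qed.

Lemma measurable_dot (f g : 'rV[R]_n -> 'rV[R]_n) :
  (forall i, measurable_fun setT (fun y => f y 0 i)) ->
  (forall i, measurable_fun setT (fun y => g y 0 i)) ->
  measurable_fun setT (fun y => dot (f y) (g y)).
Proof.
move=> mf mg; rewrite /dot; apply: measurable_sum => i.
exact: measurable_funM.
Qed.

Lemma measurable_coordB x i : measurable_fun setT (fun y : 'rV[R]_n => (y - x) 0 i).
Proof.
under eq_fun do rewrite 2!mxE.
exact: measurable_funB (measurable_rV_coord i) (measurable_cst _).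
Qed.

Lemma measurable_enormB x : measurable_fun setT (fun y => enorm (y - x)).
Proof.
under eq_fun do rewrite /enorm -powR12_sqrt ?dot_ge0//.
apply: (measurableT_comp (measurable_powR _)).
by apply: measurable_dot => i; exact: measurable_coordB.
Qed.

Lemma measurable_eball x r : measurable (eball x r).
Proof.
have -> : eball x r = (fun y => enorm (y - x)) @^-1` `]-oo, r[%classic.
  by apply/seteqP; split=> y; rewrite /= in_itv.
rewrite -[X in measurable X]setTI.
by apply: measurable_enormB => //; exact: measurable_itv.
Qed.

Lemma measurable_affine x a (b : R) : measurable_fun setT (affine x a b).
Proof.
apply: measurable_funD; first exact: measurable_cst.
apply: measurable_dot => i; [exact: measurable_cst|exact: measurable_coordB].
Qed.

Lemma subset_eball x r r' : r <= r' -> eball x r `<=` eball x r'.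
Proof. by move=> rr' y /lt_le_trans; exact. Qed.

(** A cube of side [r] in the orthant at [x] given by the signs of [a]: the i-th coordinate of y - x
    has modulus between r and 2r and the sign of a_i, so each term a_i (y - x)_i is at least r
    |a_i|. The sides are half-open to match [leb_box]. *)
Definition cell r x a : set 'rV[R]_n :=
  [set y | forall i, let c := if 0 <= a 0 i then x 0 i + r else x 0 i - 2 * r in
     c < y 0 i <= c + r].

Let corner r x a : 'rV[R]_n :=
  \row_i (if 0 <= a 0 i then x 0 i + r else x 0 i - 2 * r).

Lemma cellE r x a : cell r x a =
  [set y | forall i, corner r x a 0 i < y 0 i <= (corner r x a + const_mx r) 0 i].
Proof.
by apply/seteqP; split => y H i; have := H i; rewrite !mxE.
Qed.

Lemma measurable_cell r x a : measurable (cell r x a).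
Proof. by rewrite cellE; exact: measurable_rV_box. Qed.

Lemma leb_cell r x a : 0 <= r -> leb R n (cell r x a) = (r ^+ n)%:E.
Proof.
move=> r0; rewrite cellE leb_box; last by move=> i; rewrite !mxE lerDl.
congr EFin; rewrite (eq_bigr (fun=> r)) ?prodr_const ?card_ord// => i _.
by rewrite !mxE addrAC subrr add0r.
Qed.

Lemma cell_bounds r x a y i : 0 < r -> cell r x a y ->
  r * `|a 0 i| <= a 0 i * (y - x) 0 i /\ `|(y - x) 0 i| <= 2 * r.
Proof.
move=> r0 /(_ i) /=; rewrite !mxE; case: (leP 0 (a 0 i)) => a0 /andP[y1 y2].
  split; first by rewrite (ger0_norm a0) mulrC ler_wpM2l//; lra.
  by rewrite ler_norml; apply/andP; split; lra.
split; last by rewrite ler_norml; apply/andP; split; lra.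
rewrite (ltr0_norm a0).
have : 0 <= - a 0 i * (- r - (y 0 i - x 0 i)) by rewrite mulr_ge0//; lra.
nra.
Qed.

(** At the scale r/(4n) each coordinate of y - x is at most r/(2n), so even its l1 norm is at most
    r/2. *)
Lemma cell_sub_eball r x a : (0 < n)%N -> 0 < r ->
  cell (r / (4 * n%:R)) x a `<=` eball x r.
Proof.
move=> n0 r0 y Hy; rewrite /eball /=.
have n0R : 0 < n%:R :> R by rewrite ltr0n.
apply: le_lt_trans (enorm_le_l1norm _) _.
apply: (@le_lt_trans _ _ (\sum_(i < n) (2 * (r / (4 * n%:R))))).
  apply: ler_sum => i _.
  by have [] := cell_bounds i _ Hy; rewrite ?divr_gt0 ?mulr_gt0.
rewrite sumr_const card_ord -[ltLHS]mulr_natr.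
have -> : 2 * (r / (4 * n%:R)) * n%:R = r / 2 by field; lra.
lra.
Qed.

Lemma eball_sub_box r x : eball x r `<=`
  [set y | forall i, (x - const_mx r) 0 i < y 0 i <= (x + const_mx r) 0 i].
Proof.
move=> y /= yr i; rewrite !mxE.
have := le_lt_trans (ler_coord_enorm (y - x) i) yr.
by rewrite !mxE ltr_norml => /andP[]; lra.
Qed.

(** Ball volumes enter the estimates through cubes: a circumscribed box here, an inscribed cell for
    the lower bound. *)
Lemma leb_eball_le x r : 0 <= r -> (leb R n (eball x r) <= ((2 * r) ^+ n)%:E)%E.
Proof.
move=> r0.
have -> : (2 * r) ^+ n = \prod_i ((x + const_mx r) 0 i - (x - const_mx r) 0 i).
  rewrite (eq_bigr (fun=> 2 * r)) ?prodr_const ?card_ord// => i _.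
  by rewrite !mxE; lra.
rewrite -leb_box; last by move=> i; rewrite !mxE; lra.
apply: le_measure (@eball_sub_box r x); rewrite inE.
  exact: measurable_eball.
exact: measurable_rV_box.
Qed.

Lemma leb_eball_ge x r : (0 < n)%N -> 0 < r ->
  (((r / (4 * n%:R)) ^+ n)%:E <= leb R n (eball x r))%E.
Proof.
move=> n0 r0; rewrite -(leb_cell x 0); last by rewrite divr_ge0 ?mulr_ge0// ltW.
apply: le_measure; rewrite ?inE; [exact: measurable_cell|exact: measurable_eball|].
exact: cell_sub_eball.
Qed.

Lemma fin_num_leb_eball x r : 0 <= r -> leb R n (eball x r) \is a fin_num.
Proof.
move=> r0; rewrite ge0_fin_numE ?measure_ge0//.
exact: le_lt_trans (leb_eball_le _ r0) (ltry _).
Qed.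

Definition vol x r : R := fine (leb R n (eball x r)).

Lemma vol_le x r : 0 <= r -> vol x r <= (2 * r) ^+ n.
Proof. by move=> r0; rewrite -lee_fin fineK ?leb_eball_le ?fin_num_leb_eball. Qed.

Lemma vol_ge x r : (0 < n)%N -> 0 < r -> (r / (4 * n%:R)) ^+ n <= vol x r.
Proof.
by move=> n0 r0; rewrite -lee_fin fineK ?leb_eball_ge ?fin_num_leb_eball// ltW.
Qed.

Lemma vol_gt0 x r : (0 < n)%N -> 0 < r -> 0 < vol x r.
Proof.
move=> n0 r0; apply: lt_le_trans (vol_ge x n0 r0).
by rewrite exprn_gt0// divr_gt0// mulr_gt0// ltr0n.
Qed.

(** The outer cube has side 2r and the inner cell side r'/(4n); the quotient of the sides is at most
    8nM. *)
Lemma vol_ratio x r r' M : (0 < n)%N -> 0 < r' -> 0 <= r -> r <= M * r' ->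
  vol x r / vol x r' <= (8 * n%:R * M) ^+ n.
Proof.
move=> n0 r'0 r0 rM; rewrite ler_pdivrMr ?vol_gt0//.
apply: le_trans (vol_le x r0) _.
have n0R : 0 < n%:R :> R by rewrite ltr0n.
have M0 : 0 <= M by rewrite -(pmulr_lge0 _ r'0) (le_trans r0).
apply: le_trans (ler_wpM2l _ (vol_ge x n0 r'0)); last first.
  by rewrite exprn_ge0// mulr_ge0// mulr_ge0.
rewrite -exprMn.
have -> : 8 * n%:R * M * (r' / (4 * n%:R)) = 2 * (M * r') by field; lra.
by rewrite lerXn2r ?nnegrE ?mulr_ge0 ?ler_wpM2l// ltW.
Qed.

End Euclidean_balls.

(** * Averaged L^m bounds and the comparison of affine functions *)

Section averages.
Context (R : realType) (n : nat) (m : R).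
Hypotheses (n0 : (0 < n)%N) (m0 : 0 < m).
Implicit Types (x a : 'rV[R]_n) (w u : 'rV[R]_n -> R) (r c b d h : R).

(** This turns bounds on [Lmean] and [Tail] into bounds on integrals, where monotonicity and
    additivity apply. [X] may be infinite. *)
Lemma poweR_inv_le (X : \bar R) c : (0 <= X)%E -> 0 <= c ->
  ((X `^ m^-1 <= c%:E) = (X <= (c `^ m)%:E))%E.
Proof.
move=> X0 c0; apply/idP/idP => H.
  have := @gt0_ler_poweR R m (ltW m0) (X `^ m^-1)%E c%:E.
  rewrite -poweRrM mulVf ?gt_eqF// poweRe1// poweR_EFin.
  by apply; rewrite // in_itv /= ?poweR_ge0 ?lee_fin ?c0 ?leey.
have := @gt0_ler_poweR R m^-1 _ X (c `^ m)%:E.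
rewrite poweR_EFin -powRrM mulfV ?gt_eqF// powRr1//; apply => //.
- by rewrite invr_ge0 ltW.
- by rewrite in_itv/= X0 leey.
- by rewrite in_itv/= lee_fin powR_ge0 leey.
Qed.

Lemma Lmean_le w x r c : 0 < r -> 0 <= c ->
  (Lmean m w (eball x r) <= c%:E)%E <->
  (\int[leb R n]_(y in eball x r) (`|w y| `^ m)%:E <= (vol x r * c `^ m)%:E)%E.
Proof.
move=> r0 c0; have v0 := vol_gt0 x n0 r0.
have I0 : (0 <= \int[leb R n]_(y in eball x r) (`|w y| `^ m)%:E)%E.
  by apply: integral_ge0 => y _; rewrite lee_fin powR_ge0.
rewrite /Lmean poweR_inv_le//; last by rewrite mule_ge0// lee_fin invr_ge0 ltW.
by rewrite EFinM -lee_pdivrMl.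
Qed.

Lemma Lmean_ge0 w B : (0 <= Lmean m w B)%E.
Proof. exact: poweR_ge0. Qed.

(** The modulus of the sum is at most twice the larger modulus, whence the constant 2^m. It plays
    the part of Minkowski's inequality, for every positive exponent. *)
Lemma powR_norm_le (s t : R) : `|s + t| `^ m <= 2 `^ m * (`|s| `^ m + `|t| `^ m).
Proof.
wlog st : s t / `|s| <= `|t|.
  move=> H; have [/H//|/ltW/H] := leP `|s| `|t|.
  by rewrite addrC [X in _ <= _ * X]addrC.
apply: (@le_trans _ _ ((2 * `|t|) `^ m)).
  rewrite ge0_ler_powR ?nnegrE ?mulr_ge0//; first exact: ltW.
  by rewrite (le_trans (ler_normD _ _))//; lra.
by rewrite powRM// ler_wpM2l ?powR_ge0// lerDr powR_ge0.
Qed.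

Lemma measurable_normpowR (D : set 'rV[R]_n) w : measurable_fun setT w ->
  measurable_fun D (fun y => (`|w y| `^ m)%:E).
Proof.
move=> mw; apply/measurable_funTS/measurable_EFinP.
apply: (measurableT_comp (measurable_powR _)).
exact: measurableT_comp.
Qed.

Local Ltac side := solve
  [ exact: measurable_eball | exact: measurable_cell | exact: measurable_normpowR
  | by move=> y _; rewrite -?EFinD lee_fin ?addr_ge0 ?powR_ge0
  | by apply: emeasurable_funD => //; exact: measurable_normpowR ].

Lemma integral_eball_cst x r c : 0 < r ->
  (\int[leb R n]_(y in eball x r) c%:E)%E = (c * vol x r)%:E.
Proof.
move=> r0; rewrite EFinM /vol fineK ?fin_num_leb_eball ?(ltW r0)//.
exact: integral_cst (measurable_eball x r) c%:E.
Qed.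

Lemma integral_cell_cst x a r c : 0 < r ->
  (\int[leb R n]_(y in cell r x a) c%:E)%E = (c * r ^+ n)%:E.
Proof.
move=> r0; rewrite EFinM -(leb_cell x a (ltW r0)).
exact: integral_cst (measurable_cell r x a) c%:E.
Qed.

Lemma powR_root_bound (K s t : R) : 0 <= K -> 0 <= s -> 0 <= t ->
  s `^ m <= K * t `^ m -> s <= K `^ m^-1 * t.
Proof.
move=> K0 s0 t0 H.
have := @ge0_ler_powR R m^-1 _ (s `^ m) (K * t `^ m).
rewrite powRM ?powR_ge0// -!powRrM mulfV ?gt_eqF// !powRr1//; apply => //.
- by rewrite invr_ge0 ltW.
- by rewrite nnegrE powR_ge0.
- by rewrite nnegrE mulr_ge0 ?powR_ge0.
Qed.

Lemma powR_inv_K (K : R) : 0 <= K -> (K `^ m^-1) `^ m = K.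
Proof. by move=> K0; rewrite -powRrM mulVf ?gt_eqF// powRr1. Qed.

Lemma add_powR_le (c d : R) : 0 <= c -> 0 <= d ->
  c `^ m + d `^ m <= 2 * (c + d) `^ m.
Proof.
move=> c0 d0; rewrite (_ : 2 = 1 + 1) ?mulrDl ?mul1r//.
by rewrite lerD// ge0_ler_powR ?nnegrE ?addr_ge0 ?lerDl ?lerDr// ltW.
Qed.

(** The m-th root of the bound in [vol_ratio]: passing to a smaller concentric ball only changes the
    normalisation of the average. *)
Definition Kshrink (M : R) : R := ((8 * n%:R * M) ^+ n) `^ m^-1.

Lemma Lmean_shrink (M : R) w x r r' c : measurable_fun setT w ->
  0 < r' -> r' <= r -> r <= M * r' -> 0 <= c ->
  (Lmean m w (eball x r) <= c%:E)%E ->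
  (Lmean m w (eball x r') <= (Kshrink M * c)%:E)%E.
Proof.
move=> mw r'0 r'r rM c0.
have r0 : 0 < r by exact: lt_le_trans r'r.
have M0 : 0 <= M by rewrite -(pmulr_lge0 _ r'0) (le_trans (ltW r0)).
have KM0 : 0 <= (8 * n%:R * M) ^+ n by rewrite exprn_ge0// !mulr_ge0.
move=> /(Lmean_le _ _ r0 c0) H.
apply/Lmean_le; rewrite ?mulr_ge0 ?powR_ge0//.
apply: le_trans (ge0_subset_integral _ _ _ _ _ (subset_eball (x:=x) r'r)) _.
- exact: measurable_eball.
- exact: measurable_eball.
- exact: measurable_normpowR.
- by move=> y _; rewrite lee_fin powR_ge0.
apply: le_trans H _; rewrite lee_fin powRM ?powR_ge0// powR_inv_K//.
rewrite mulrA ler_wpM2r ?powR_ge0// mulrC -ler_pdivrMr ?vol_gt0//.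
by apply: vol_ratio => //; exact: ltW.
Qed.

(** Serves to replace the k-th affine function by the limit one. In the constant, 2^m comes from
    [powR_norm_le] and 2 from [add_powR_le]. *)
Lemma Lmean_perturb w w' x r c d : measurable_fun setT w -> measurable_fun setT w' ->
  0 < r -> 0 <= c -> 0 <= d ->
  (forall y, eball x r y -> `|w' y - w y| <= d) ->
  (Lmean m w (eball x r) <= c%:E)%E ->
  (Lmean m w' (eball x r) <= ((2 `^ m * 2) `^ m^-1 * (c + d))%:E)%E.
Proof.
move=> mw mw' r0 c0 d0 wd.
move=> /(Lmean_le _ _ r0 c0) H.
apply/Lmean_le; rewrite ?mulr_ge0 ?powR_ge0 ?addr_ge0//.
pose f y : \bar R := ((2 `^ m)%:E * ((`|w y| `^ m)%:E + (d `^ m)%:E))%E.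
apply: (@le_trans _ _ (\int[leb R n]_(y in eball x r) f y)%E).
  apply: ge0_le_integral => //=.
  - exact: measurable_eball.
  - exact: measurable_normpowR.
  - apply: emeasurable_funM => //.
    by apply: emeasurable_funD => //; exact: measurable_normpowR.
  - move=> y By; rewrite /f -EFinD -EFinM lee_fin.
    rewrite -[w' y](subrK (w y)) addrC (le_trans (powR_norm_le _ _))//.
    rewrite ler_wpM2l ?powR_ge0// lerD2l ge0_ler_powR ?nnegrE//; first exact: ltW.
    exact: wd.
rewrite ge0_integralZl_EFin ?powR_ge0//; try side.
rewrite ge0_integralD//; try side.
rewrite integral_eball_cst//.
have v0 := vol_gt0 x n0 r0.
apply: (@le_trans _ _ ((2 `^ m)%:E * ((vol x r * c `^ m)%:E + (d `^ m * vol x r)%:E))%E).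
  by rewrite lee_wpmul2l ?lee_fin ?powR_ge0// leeD.
rewrite -EFinD -EFinM lee_fin powRM ?addr_ge0 ?powR_ge0//.
rewrite powR_inv_K ?mulr_ge0 ?powR_ge0//.
rewrite (_ : _ + _ = vol x r * (c `^ m + d `^ m)); last by ring.
rewrite [leLHS]mulrCA ler_pM2l// -mulrA ler_wpM2l ?powR_ge0//.
exact: add_powR_le.
Qed.

Lemma measurable_affineB u x a b : measurable_fun setT u ->
  measurable_fun setT (fun y => u y - affine x a b y).
Proof. by move=> mu; apply: measurable_funB => //; exact: measurable_affine. Qed.

Lemma affineB x a a' b b' y :
  affine x a b y - affine x a' b' y = b - b' + dot (a - a') (y - x).
Proof.
rewrite /affine opprD addrACA; congr (_ + _); rewrite /dot -sumrB.
by apply: eq_bigr => i _; rewrite !mxE mulrBl.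
Qed.


(* On the cell chosen by the signs of [a], all terms of the affine function have
   the sign of [b], so that nothing cancels. *)
Lemma affine_cell x a b h : 0 < h -> exists a0, forall y, cell h x a0 y ->
  `|b| + h * l1norm a <= `|b + dot a (y - x)|.
Proof.
move=> h0.
(* For negative b both signs are flipped, and the cell obtained is the one of -a; this is why the
   cell is only claimed to exist. *)
wlog b0 : a b / 0 <= b => [H|].
  have [/H//|/ltW b0] := leP 0 b.
  have [|a0 Ha] := H (- a) (- b); first by rewrite oppr_ge0.
  exists a0 => y /Ha; rewrite normrN.
  rewrite l1normN.
  suff -> : dot (- a) (y - x) = - dot a (y - x) by rewrite -opprD normrN.
  by rewrite /dot -sumrN; apply: eq_bigr => i _; rewrite mxE mulNr.
exists a => y Hy; apply: le_trans (ler_norm _).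
rewrite ger0_norm// lerD2l /l1norm mulr_sumr; apply: ler_sum => i _.
by have [] := cell_bounds i h0 Hy.
Qed.

(** With h = r/(4n) the side of the cell, (8n)^n bounds the volume of the ball divided by h^n, and
    the outer 4n converts h back into r. The factors 2^m and 2 come from [powR_norm_le] and
    [add_powR_le]. *)
Definition Kaff : R := 4 * n%:R * (2 `^ m * (8 * n%:R) ^+ n * 2) `^ m^-1.

Lemma Kaff_ge0 : 0 <= Kaff.
Proof. by rewrite !mulr_ge0 ?powR_ge0. Qed.

(** On a suitable cell the difference of the affine functions is at least the constant [de], while
    it is at most the sum of their distances to u. Integrating over the cell bounds [de] by averages
    on the ball. *)
Lemma affine_diff u x a a' b b' r c c' : measurable_fun setT u ->
  0 < r -> 0 <= c -> 0 <= c' ->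
  (Lmean m (fun y => (u y - affine x a b y)%R) (eball x r) <= c%:E)%E ->
  (Lmean m (fun y => (u y - affine x a' b' y)%R) (eball x r) <= c'%:E)%E ->
  `|b - b'| + r * l1norm (a - a') <= Kaff * (c + c').
Proof.
move=> mu r0 c0 c'0 /(Lmean_le _ _ r0 c0) H /(Lmean_le _ _ r0 c'0) H'.
have n0R : 0 < n%:R :> R by rewrite ltr0n.
have n1R : 1 <= n%:R :> R by rewrite ler1n.
pose h := r / (4 * n%:R); have h0 : 0 < h by rewrite divr_gt0 ?mulr_gt0.
have [a0 Ha] := affine_cell x (a - a') (b - b') h0.
set de := `|b - b'| + h * l1norm (a - a') in Ha.
have de0 : 0 <= de by rewrite addr_ge0// mulr_ge0 ?l1norm_ge0// ltW.
have mB := measurable_eball x r.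
have mw := measurable_affineB x a b mu.
have mw' := measurable_affineB x a' b' mu.
set w := (fun y => u y - affine x a b y) in H mw.
set w' := (fun y => u y - affine x a' b' y) in H' mw'.
pose f y : \bar R := ((2 `^ m)%:E * ((`|w y| `^ m)%:E + (`|w' y| `^ m)%:E))%E.
have mf D : measurable_fun D f.
  apply: emeasurable_funM => //.
  by apply: emeasurable_funD => //; exact: measurable_normpowR.
have f0 y : (0 <= f y)%E by rewrite /f -EFinD -EFinM lee_fin mulr_ge0 ?addr_ge0 ?powR_ge0.
have low : ((h ^+ n * de `^ m)%:E <= \int[leb R n]_(y in eball x r) f y)%E.
  apply: le_trans (ge0_subset_integral (leb R n) (measurable_cell h x a0) mB (mf _)
    (fun y _ => f0 y) (cell_sub_eball n0 r0)).
  rewrite mulrC -(integral_cell_cst x a0)//.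
  apply: ge0_le_integral => //=; try side.
  - move=> y /Ha Hy; rewrite /f -EFinD -EFinM lee_fin.
    rewrite addrC -(normrN (w y)); apply: le_trans (powR_norm_le _ _).
    rewrite ge0_ler_powR ?nnegrE//; first exact: ltW.
    rewrite (le_trans Hy)// -affineB.
    by rewrite (_ : w' y + - w y = affine x a b y - affine x a' b' y)// /w /w'; ring.
have up : (\int[leb R n]_(y in eball x r) f y <=
    (2 `^ m * (vol x r * c `^ m + vol x r * c' `^ m))%:E)%E.
  rewrite ge0_integralZl_EFin ?powR_ge0//; try side.
  rewrite ge0_integralD//; try side.
  by rewrite EFinM lee_wpmul2l ?lee_fin ?powR_ge0// EFinD leeD.
have := le_trans low up; rewrite lee_fin => {low up}lu.
have hn0 : 0 < h ^+ n by rewrite exprn_gt0.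
have vh : vol x r <= (8 * n%:R) ^+ n * h ^+ n.
  apply: le_trans (vol_le x (ltW r0)) _; rewrite -exprMn.
  by rewrite (_ : 8 * n%:R * h = 2 * r)// /h; field; lra.
have K0 : 0 <= 2 `^ m * (8 * n%:R) ^+ n * 2 by rewrite !mulr_ge0 ?powR_ge0.
have de_le : de `^ m <= 2 `^ m * (8 * n%:R) ^+ n * 2 * (c + c') `^ m.
  rewrite -(ler_pM2l hn0); apply: le_trans lu _; rewrite -mulrDr.
  apply: (@le_trans _ _ (2 `^ m * ((8 * n%:R) ^+ n * h ^+ n * (2 * (c + c') `^ m)))).
    rewrite ler_wpM2l ?powR_ge0//; apply: ler_pM => //.
    - exact/ltW/vol_gt0.
    - by rewrite addr_ge0 ?powR_ge0.
    - exact: add_powR_le.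
  by rewrite le_eqVlt; apply/orP; left; apply/eqP; ring.
have := powR_root_bound K0 de0 (addr_ge0 c0 c'0) de_le => {}de_le.
(* Multiplying by 4n turns h into r in front of the slope and, as 4n is at least 1, does not
   decrease the other term. *)
apply: (@le_trans _ _ (4 * n%:R * de)); last first.
  by rewrite /Kaff -[leRHS]mulrA ler_wpM2l// mulr_ge0.
rewrite /de mulrDr mulrA (_ : 4 * n%:R * h = r); last by rewrite /h; field; lra.
by rewrite lerD2r ler_peMl//; lra.
Qed.

End averages.

(** * Excess with tail: change of radius and finiteness *)

Section excess_bounds.
Context (R : realType) (n : nat) (m t : R).
Hypotheses (n0 : (0 < n)%N) (m0 : 0 < m) (t0 : 0 < t).
Implicit Types (x a : 'rV[R]_n) (w u : 'rV[R]_n -> R) (r c b d h : R).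

Let kernel w x y : \bar R := (`|w y| `^ m / enorm (y - x) `^ (n%:R + t))%:E.

Let kernel_ge0 w x y : (0 <= kernel w x y)%E.
Proof. by rewrite lee_fin divr_ge0 ?powR_ge0. Qed.

Let measurable_kernel (D : set 'rV[R]_n) w x : measurable_fun setT w ->
  measurable_fun D (kernel w x).
Proof.
move=> mw; apply/measurable_funTS/measurable_EFinP.
apply: measurable_funM.
  apply: (measurableT_comp (measurable_powR _)).
  exact: measurableT_comp.
under eq_fun do rewrite -powRN.
apply: (measurableT_comp (measurable_powR _)).
exact: measurable_enormB.
Qed.

Let nt0 : 0 < n%:R + t.
Proof. by rewrite ltr_wpDl. Qed.

Lemma Tail_le w x r c : 0 <= c ->
  (Tail m t w x r <= c%:E)%E <->
  ((r `^ t)%:E * \int[leb R n]_(y in ~` eball x r)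
      (`|w y| `^ m / enorm (y - x) `^ (n%:R + t))%:E <= (c `^ m)%:E)%E.
Proof.
move=> c0; rewrite /Tail poweR_inv_le// mule_ge0 ?lee_fin ?powR_ge0//.
by apply: integral_ge0 => y _; exact: kernel_ge0.
Qed.

Lemma excess_ge0 w x r : 0 < r -> (0 <= excess m t w x r)%E.
Proof.
by move=> r0; rewrite adde_ge0// mule_ge0 ?poweR_ge0// lee_fin invr_ge0 ltW.
Qed.

Lemma excess_le_Lmean w x r c : 0 < r -> (excess m t w x r <= c%:E)%E ->
  (Lmean m w (eball x r) <= (r * c)%:E)%E.
Proof.
move=> r0 H; rewrite EFinM -lee_pdivrMl//; apply: le_trans H.
by rewrite leeDl// mule_ge0 ?poweR_ge0// lee_fin invr_ge0 ltW.
Qed.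

Lemma excess_le_Tail w x r c : 0 < r -> (excess m t w x r <= c%:E)%E ->
  (Tail m t w x r <= (r * c)%:E)%E.
Proof.
move=> r0 H; rewrite EFinM -lee_pdivrMl//; apply: le_trans H.
by rewrite leeDr// mule_ge0 ?poweR_ge0// lee_fin invr_ge0 ltW.
Qed.

Lemma kernel_integral_le w x r (A : set 'rV[R]_n) : measurable_fun setT w ->
  measurable A -> 0 < r -> A `<=` ~` eball x r ->
  (\int[leb R n]_(y in A) (`|w y| `^ m / enorm (y - x) `^ (n%:R + t))%:E <=
   (r `^ (n%:R + t))^-1%:E * \int[leb R n]_(y in A) (`|w y| `^ m)%:E)%E.
Proof.
move=> mw mA r0 AB.
have rn0 : 0 < r `^ (n%:R + t) by rewrite powR_gt0.
rewrite -ge0_integralZl_EFin//; last 2 first.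
- exact: measurable_normpowR.
- by rewrite invr_ge0 ltW.
apply: ge0_le_integral => //=.
- by move=> y _; exact: kernel_ge0.
- exact: measurable_kernel.
- by apply: emeasurable_funM => //; exact: measurable_normpowR.
- move=> y /AB/negP; rewrite -leNgt => ry.
  rewrite -EFinM lee_fin mulrC ler_wpM2r ?powR_ge0//.
  have e0 : 0 < enorm (y - x) by exact: lt_le_trans ry.
  by rewrite lef_pV2 ?posrE ?powR_gt0// ge0_ler_powR ?nnegrE// ltW.
Qed.

(** The factor 4 is the ratio of the prefactors 1/(rho/2) and 1/(2 rho); 1 stands for the old tail
    and 8^n for the annulus between the two balls. *)
Definition Kquarter : R :=
  4 * (Kshrink n m 4 + (1 + 8 ^+ n) `^ m^-1).

Lemma Kquarter_ge0 : 0 <= Kquarter.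
Proof. by rewrite mulr_ge0 ?addr_ge0 ?powR_ge0. Qed.

(** The new tail splits into the old one, whose prefactor only decreases, and an annulus. There the
    kernel is at most (rho/2)^(-n-t), so the integral is controlled by the average over the large
    ball. *)
Lemma excess_quarter w x rho c : measurable_fun setT w -> 0 < rho -> 0 <= c ->
  (excess m t w x (2 * rho) <= c%:E)%E ->
  (excess m t w x (rho / 2) <= (Kquarter * c)%:E)%E.
Proof.
move=> mw rho0 c0 H.
have r20 : 0 < 2 * rho by rewrite mulr_gt0.
have r0 : 0 < rho / 2 by rewrite divr_gt0.
have d0 : 0 <= 2 * rho * c by rewrite mulr_ge0// ltW.
have Lbig := excess_le_Lmean r20 H.
have Lsmall : (Lmean m w (eball x (rho / 2)) <=
    (Kshrink n m 4 * (2 * rho * c))%:E)%E.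
  by apply: Lmean_shrink Lbig => //; lra.
have Tsmall : (Tail m t w x (rho / 2) <= ((1 + 8 ^+ n) `^ m^-1 * (2 * rho * c))%:E)%E.
  apply/Tail_le; first by rewrite mulr_ge0 ?powR_ge0.
  rewrite powRM ?powR_ge0// powR_inv_K ?addr_ge0 ?exprn_ge0// mulrDl mul1r.
  have sub : eball x (rho / 2) `<=` eball x (2 * rho) by apply: subset_eball; lra.
  have mS := measurable_eball x (rho / 2); have mL := measurable_eball x (2 * rho).
  have -> : ~` eball x (rho / 2) =
      ~` eball x (2 * rho) `|` (eball x (2 * rho) `\` eball x (rho / 2)).
    apply/seteqP; split=> y.
      by move=> yS; have [yL|yL] := pselect (eball x (2 * rho) y); [right|left].
    by case=> [yL /sub//|[_ //]].
  have mD : measurable (eball x (2 * rho) `\` eball x (rho / 2)) by exact: measurableD.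
  rewrite ge0_integral_setU//; first last.
  - by apply/disj_setPS => y [yL [/yL]].
  - by move=> y _; exact: kernel_ge0.
  - exact: measurable_kernel.
  - exact: measurableC.
  rewrite ge0_muleDr; first last.
  - by apply: integral_ge0 => y _; exact: kernel_ge0.
  - by apply: integral_ge0 => y _; exact: kernel_ge0.
  rewrite EFinD; apply: leeD.
    move/(Tail_le _ _ _ d0): (excess_le_Tail r20 H).
    apply: le_trans; apply: lee_wpmul2r.
      by apply: integral_ge0 => y _; exact: kernel_ge0.
    by rewrite lee_fin ge0_ler_powR ?nnegrE ?ltW//; lra.
  apply: (@le_trans _ _ (((rho / 2) `^ t)%:E *
     ((rho / 2) `^ (n%:R + t))^-1%:E * (vol x (2 * rho) * (2 * rho * c) `^ m)%:E)%E).
    rewrite -muleA; apply: lee_wpmul2l; first by rewrite lee_fin powR_ge0.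
    apply: le_trans (kernel_integral_le mw mD r0 _) _; first by move=> y [].
    apply: lee_wpmul2l; first by rewrite lee_fin invr_ge0 powR_ge0.
    move/(Lmean_le n0 m0 _ _ r20 d0): Lbig; apply: le_trans.
    apply: ge0_subset_integral => //.
    exact: measurable_normpowR.
  rewrite -!EFinM lee_fin mulrA ler_wpM2r ?powR_ge0//.
  rewrite powRD ?gt_eqF ?implybT//.
  have p0 : (rho / 2) `^ t != 0 by rewrite gt_eqF ?powR_gt0.
  have q0 : 0 < (rho / 2) ^+ n by rewrite exprn_gt0.
  rewrite powR_mulrn; last exact: ltW.
  rewrite invfM mulrCA mulfV// mulr1 mulrC ler_pdivrMr// -exprMn.
  apply: le_trans (vol_le x (ltW r20)) _.
  by rewrite (_ : 8 * (rho / 2) = 2 * (2 * rho))//; lra.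
rewrite /excess -ge0_muleDr ?poweR_ge0//.
apply: (@le_trans _ _ ((rho / 2)^-1%:E * (Kshrink n m 4 * (2 * rho * c)
    + (1 + 8 ^+ n) `^ m^-1 * (2 * rho * c))%:E)%E).
  by apply: lee_wpmul2l; rewrite ?EFinD ?leeD// lee_fin invr_ge0 ltW.
rewrite -EFinM lee_fin /Kquarter le_eqVlt; apply/orP; left; apply/eqP.
by field; lra.
Qed.

(** Off the ball the weight is at most r^(-n-t), so the global integral controls both terms. *)
Lemma excess_lty w x r : measurable_fun setT w -> 0 < r ->
  (\int[leb R n]_y (`|w y| `^ m)%:E < +oo)%E -> (excess m t w x r < +oo)%E.
Proof.
move=> mw r0 woo.
have r'0 : (0 <= r^-1%:E)%E by rewrite lee_fin invr_ge0 ltW.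
have mB := measurable_eball x r.
have sub A : measurable A -> (\int[leb R n]_(y in A) (`|w y| `^ m)%:E < +oo)%E.
  move=> mA; apply: le_lt_trans woo.
  by apply: ge0_subset_integral => //; exact: measurable_normpowR.
apply: lte_add_pinfty; apply: lte_mul_pinfty => //; apply: poweR_lty.
  apply: lte_mul_pinfty; [|by []|exact: sub].
  by rewrite lee_fin invr_ge0 ltW// vol_gt0.
apply: lte_mul_pinfty; [by rewrite lee_fin powR_ge0|by []|].
apply: le_lt_trans (kernel_integral_le mw _ r0 _) _.
- exact: measurableC.
- by [].
apply: lte_mul_pinfty; [by rewrite lee_fin invr_ge0 powR_ge0|by []|].
by apply: sub; exact: measurableC.
Qed.

End excess_bounds.

(** * Global L^m integrability of functions vanishing outside a bounded set *)

Section integrability_outside.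
Context (R : realType) (n : nat) (m q : R) (U : set 'rV[R]_n).
Hypotheses (m0 : 0 < m) (mq : m <= q).

(** [bounded_set] refers to the sup norm, whence the factor n in the Euclidean radius. *)
Lemma bounded_set_eball : bounded_set U -> exists2 r : R, 0 < r & U `<=` eball 0 r.
Proof.
move=> [M [Mreal bU]]; pose M' := `|M| + 1.
have M'0 : 0 < M' by rewrite ltr_wpDl.
exists (n%:R * M' + 1); first by rewrite ltr_wpDl// mulr_ge0// ltW.
move=> y Uy; rewrite /eball /= subr0.
apply: le_lt_trans (enorm_le_l1norm y) _.
apply: (@le_lt_trans _ _ (n%:R * M')); last by rewrite ltrDl.
rewrite -[X in X%:R * _]card_ord mulr_natl -sumr_const; apply: ler_sum => i _.
have yM : `|y| <= M'.
  by apply: (bU M') => //; rewrite /M' (le_lt_trans (ler_norm M))// ltrDl.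
apply: le_trans yM; rewrite [leRHS]mx_normrE.
exact: (le_bigmax _ (fun j : 'I_1 * 'I_n => `|y j.1 j.2|) (0, i)).
Qed.

(** On U, which has finite measure, |u|^m is at most 1 + |u|^q; outside U the function vanishes
    almost everywhere. *)
Lemma lty_integral_powR (u : 'rV[R]_n -> R) : open U -> bounded_set U ->
  measurable_fun setT u -> zero_outside U u ->
  (\int[leb R n]_(x in U) (`|u x| `^ q)%:E < +oo)%E ->
  (\int[leb R n]_x (`|u x| `^ m)%:E < +oo)%E.
Proof.
move=> oU bU mu zu uq.
have mU := open_rV_measurable oU.
have -> : (\int[leb R n]_x (`|u x| `^ m)%:E =
    \int[leb R n]_(x in U) (`|u x| `^ m)%:E)%E.
  rewrite [RHS]integral_mkcond; apply: ae_eq_integral => //.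
  - exact: measurable_normpowR.
  - by apply/(measurable_restrictT _ mU); exact: measurable_normpowR.
  - apply: filterS zu => x ux _; rewrite patchE; case: ifPn => // /negP.
    by rewrite inE => /ux ->; rewrite normr0 powR0// gt_eqF.
have q0 : 0 < q by exact: lt_le_trans mq.
apply: (@le_lt_trans _ _ (\int[leb R n]_(x in U) (1 + (`|u x| `^ q)%:E))%E).
  apply: ge0_le_integral => //=.
  - exact: measurable_normpowR.
  - by apply: emeasurable_funD => //; exact: measurable_normpowR.
  - move=> x _; rewrite -EFinD lee_fin; have [u1|u1] := leP `|u x| 1.
      apply: (@le_trans _ _ 1); last by rewrite lerDl powR_ge0.
      have <- : 1 `^ m = 1 :> R by rewrite powR1.
      by rewrite ge0_ler_powR ?nnegrE// ltW.
    by apply: (@le_trans _ _ (`|u x| `^ q)); rewrite ?lerDr// ler_powR// ltW.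
rewrite ge0_integralD//; last exact: measurable_normpowR.
apply: lte_add_pinfty => //.
have -> : (\int[leb R n]_(x in U) 1 = leb R n U)%E by rewrite integral_cst// mul1e.
have [r r0 Ur] := bounded_set_eball bU.
apply: (@le_lt_trans _ _ (leb R n (eball 0 r))).
  by apply: le_measure Ur; rewrite inE//; exact: measurable_eball.
by apply: le_lt_trans (leb_eball_le _ (ltW r0)) _; exact: ltry.
Qed.

End integrability_outside.

(** * Dyadic-type sums bounded by the Wolff potential *)

Section wolff_potential.
Context (R : realType) (n : nat) (s p : R).
Variables (mu : {charge set 'rV[R]_n -> \bar R}) (x : 'rV[R]_n).
Implicit Types (r rho : R).

Let nu : R := n%:R - (s * p - p + 1).
Hypotheses (p1 : 1 < p) (nu0 : 0 <= nu).

Let m0 : 0 < p - 1. Proof. by rewrite subr_gt0. Qed.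

Let TV r : \bar R := Defs.total_variation mu (eball x r).

Let TV_fin r : TV r \is a fin_num.
Proof. by apply: fin_num_measure; exact: measurable_eball. Qed.

Let TV_ge0 r : (0 <= TV r)%E.
Proof. exact: measure_ge0. Qed.

Let TV_le r r' : r <= r' -> (TV r <= TV r')%E.
Proof.
move=> rr'; apply: le_measure (subset_eball rr'); rewrite inE;
  exact: measurable_eball.
Qed.

Lemma D_mu_ge0 r : (0 <= D_mu s p mu x r)%E.
Proof. exact: poweR_ge0. Qed.

(** The mass of a ball is finite and nondecreasing in its radius, hence measurable. *)
Lemma measurable_D_mu (D : set R) : measurable_fun D (D_mu s p mu x).
Proof.
apply: measurable_funTS.
apply: (measurableT_comp (measurable_poweR _)).
apply: emeasurable_funM.
  have -> : (fun r => TV r) = EFin \o (fun r => fine (TV r)).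
    by apply/funext => r /=; rewrite fineK.
  apply/measurable_EFinP; apply: nondecreasing_measurable => // r r' rr'.
  by apply: fine_le => //; exact: TV_le.
apply/measurable_EFinP; under eq_fun do rewrite -powRN.
exact: measurable_powR.
Qed.

Definition KD : R := (2 `^ nu) `^ (p - 1)^-1.

Lemma KD_gt0 : 0 < KD.
Proof. by rewrite !powR_gt0. Qed.

(** The mass grows with the radius and r^nu at most by the factor 2^nu, since nu is nonnegative;
    [KD] is the corresponding root. *)
Lemma D_mu_le r r' : 0 < r -> r <= r' -> r' <= 2 * r ->
  (D_mu s p mu x r <= KD%:E * D_mu s p mu x r')%E.
Proof.
move=> r0 rr' r'2; have r'0 : 0 < r' by exact: lt_le_trans rr'.
rewrite /D_mu -/nu -/(TV r) -/(TV r') /KD -poweR_EFin -poweRM; first last.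
- by rewrite mule_ge0// lee_fin invr_ge0 powR_ge0.
- by rewrite lee_fin powR_ge0.
apply: gt0_ler_poweR.
- by rewrite invr_ge0 ltW.
- by rewrite in_itv/= leey andbT mule_ge0// lee_fin invr_ge0 powR_ge0.
- by rewrite in_itv/= leey andbT !mule_ge0// lee_fin ?invr_ge0 powR_ge0.
rewrite muleCA; apply: lee_pmul => //; first by rewrite lee_fin invr_ge0 powR_ge0.
  exact: TV_le.
rewrite -EFinM lee_fin ler_pdivlMr ?powR_gt0// mulrC ler_pdivrMr ?powR_gt0//.
by rewrite -powRM ?(ltW r0)// ge0_ler_powR ?nnegrE// ?mulr_ge0// ltW.
Qed.

Let F r : \bar R := (D_mu s p mu x r * r^-1%:E)%E.

Let measurable_F (a b : R) : 0 <= a -> measurable_fun `]a, b]%classic F.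
Proof.
move=> a0; apply: emeasurable_funM; first exact: measurable_D_mu.
apply/measurable_EFinP.
apply: (eq_measurable_fun (fun r : R => r `^ (-1))).
  move=> r; rewrite inE /= in_itv/= => /andP[ar _].
  by rewrite powR_inv1// (le_trans a0)// ltW.
by apply: measurable_funTS; exact: measurable_powR.
Qed.

Let F_ge0 (a b : R) : 0 <= a -> forall r, `]a, b]%classic r -> (0 <= F r)%E.
Proof.
move=> a0 r; rewrite /= in_itv/= => /andP[ar _].
by rewrite mule_ge0 ?D_mu_ge0// lee_fin invr_ge0 (le_trans a0)// ltW.
Qed.

(** On (r, 2r], an interval of length r, the integrand is at least D(r)/(KD 2r). The free endpoint
    [a] allows a larger interval, so that consecutive intervals can abut. *)
Let F_step r (a : R) : 0 < r -> 0 <= a -> a <= r ->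
  (D_mu s p mu x r <= (2 * KD)%:E * \int[lebesgue_measure]_(r' in `]a, (2 * r)%R]) F r')%E.
Proof.
move=> r0 a0 ar; have K0 := KD_gt0.
have Dfin : D_mu s p mu x r \is a fin_num.
  by apply: fin_num_poweR; rewrite fin_numM//; exact: TV_fin.
set d := fine (D_mu s p mu x r).
have d0 : 0 <= d by rewrite fine_ge0// D_mu_ge0.
apply: (@le_trans _ _ ((2 * KD)%:E * \int[lebesgue_measure]_(r' in `]r, (2 * r)%R]) F r')%E);
    last first.
  apply: lee_wpmul2l; first by rewrite lee_fin mulr_ge0// ltW.
  apply: ge0_subset_integral => //.
  - exact: measurable_F.
  - exact: F_ge0.
  - by move=> y; rewrite /= !in_itv/= => /andP[ry ->]; rewrite (le_lt_trans ar).
have low : ((d / KD / (2 * r) * r)%:E <=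
    \int[lebesgue_measure]_(r' in `]r, (2 * r)%R]) F r')%E.
  have -> : (d / KD / (2 * r) * r)%:E =
      (\int[lebesgue_measure]_(r' in `]r, (2 * r)%R]) (d / KD / (2 * r))%:E)%E.
    have -> : (\int[lebesgue_measure]_(r' in `]r, (2 * r)%R]) (d / KD / (2 * r))%:E =
        (d / KD / (2 * r))%:E * lebesgue_measure `]r, (2 * r)%R]%classic)%E.
      exact: integral_cst.
    rewrite lebesgue_measure_itv/= lte_fin ifT; last by lra.
    by rewrite -EFinB -EFinM; congr (_%:E); congr (_ * _); lra.
  apply: ge0_le_integral => //=.
  - by move=> y _; rewrite lee_fin !divr_ge0// ?mulr_ge0// ltW.
  - by apply: measurable_F; exact: ltW.
  - move=> y; rewrite in_itv/= => /andP[ry y2r].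
    have y0 : 0 < y by exact: lt_trans ry.
    rewrite EFinM; apply: lee_pmul.
    + by rewrite lee_fin divr_ge0// ltW.
    + by rewrite lee_fin invr_ge0 mulr_ge0// ltW.
    + rewrite mulrC EFinM /d fineK// lee_pdivrMl//.
      by apply: D_mu_le => //; exact: ltW.
    + by rewrite lee_fin lef_pV2 ?posrE// mulr_gt0.
apply: le_trans (lee_wpmul2l _ low); last by rewrite lee_fin mulr_ge0// ltW.
rewrite -EFinM -(fineK Dfin) -/d lee_fin le_eqVlt; apply/orP; left; apply/eqP.
by field; lra.
Qed.

Lemma sum_D_mu_le rho theta N : 0 < rho -> 0 < theta -> theta <= 2^-1 ->
  (\sum_(0 <= k < N) D_mu s p mu x (2 * (rho / 2 * theta ^+ k)) <=
   (2 * KD)%:E * wolff s p mu x (2 * rho))%E.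
Proof.
move=> rho0 th0 th2; have K0 := KD_gt0.
pose b k := 2 * (rho / 2 * theta ^+ k).
have b0 k : 0 < b k by rewrite !mulr_gt0 ?invr_gt0 ?exprn_gt0.
have bS k : 2 * b k.+1 <= b k.
  rewrite (_ : 2 * b k.+1 = b k * (2 * theta)); last by rewrite /b exprS; ring.
  by rewrite ler_piMr ?(ltW (b0 k))//; lra.
have b00 : b 0 = rho by rewrite /b expr0; lra.
have bmono k : 2 * b k <= 2 * rho.
  elim: k => [|k IH]; first by rewrite b00.
  by apply: le_trans IH; have := bS k; have := b0 k; have := b0 k.+1; lra.
have K20 : (0 <= (2 * KD)%:E)%E by rewrite lee_fin mulr_ge0// ltW.
(* The induction needs the sharper bound by the integral over (2 b_N, 2 rho]: each new term uses the
   fresh piece (2 b_{N+1}, 2 b_N], which contains (b_N, 2 b_N] by [bS]. *)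
apply: (@le_trans _ _
    ((2 * KD)%:E * \int[lebesgue_measure]_(r in `](2 * b N)%R, (2 * rho)%R]) F r)%E); last first.
  apply: lee_wpmul2l => //; apply: ge0_subset_integral => //.
  - exact: measurable_F.
  - exact: F_ge0.
  - move=> y; rewrite /= !in_itv/= => /andP[by_ ->]; rewrite andbT.
    by apply: lt_trans by_; rewrite mulr_gt0.
elim: N => [|N IH].
  rewrite big_geq// mule_ge0//; apply: integral_ge0 => y.
  by apply: F_ge0; rewrite mulr_ge0// ltW.
rewrite big_nat_recr//=.
have b20 k : 0 <= 2 * b k by rewrite mulr_ge0// ltW.
have -> : `]2 * b N.+1, 2 * rho]%classic =
    `]2 * b N.+1, 2 * b N]%classic `|` `]2 * b N, 2 * rho]%classic.
  apply/seteqP; split=> y; rewrite /= !in_itv/=.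
    move=> /andP[-> ->]; rewrite !andbT /=.
    by case: leP => _; [left|right].
  case=> /andP[y1 y2]; rewrite ?y1 ?y2 ?andbT ?(le_trans y2)//=.
  by apply: lt_trans y1; have := bS N; have := b0 N; lra.
rewrite ge0_integral_setU//; first last.
- apply/disj_setPS => y; rewrite /= !in_itv/= => -[/andP[_ y1] /andP[y2 _]].
  by move: (lt_le_trans y2 y1); rewrite ltxx.
- by move=> y [|]; exact: F_ge0.
- by apply/measurable_funU => //; split; exact: measurable_F.
rewrite ge0_muleDr; first last.
- by apply: integral_ge0 => y; exact: F_ge0.
- by apply: integral_ge0 => y; exact: F_ge0.
rewrite addeC; apply: leeD => //.
by apply: F_step; [exact: (b0 N)|exact: b20|exact: bS].
Qed.

End wolff_potential.

(** * Summation of a halving recursion and sequences with summable increments *)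

Section sequences_of_reals.
Context (R : realType).
Implicit Types (x e d g r : nat -> R).

Lemma halving_sum_le e d (C0 : R) : (forall k, 0 <= e k) ->
  (forall k, e k.+1 <= 2^-1 * e k + C0 * d k) ->
  forall N, \sum_(0 <= k < N) e k <= 2 * (e 0%N + C0 * \sum_(0 <= k < N) d k).
Proof.
move=> e0 step N.
(* The extra term closes the induction: e_N + 2 e_{N+1} is at most 2 e_N + 2 C0 d_N. *)
suff : \sum_(0 <= k < N) e k + 2 * e N <= 2 * (e 0%N + C0 * \sum_(0 <= k < N) d k).
  by apply: le_trans; rewrite lerDl mulr_ge0.
elim: N => [|N IH]; first by rewrite !big_geq// mulr0 addr0 add0r.
by rewrite !big_nat_recr//= mulrDr; move: (step N) IH; lra.
Qed.

Lemma sum_succ_le e N : (forall k, 0 <= e k) ->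
  \sum_(0 <= k < N) (e k + e k.+1) <= 2 * \sum_(0 <= k < N.+1) e k.
Proof.
move=> e0; rewrite big_split/= (_ : 2 = 1 + 1)// mulrDl mul1r lerD//.
  by rewrite [leRHS]big_nat_recr//= lerDl.
by rewrite [leRHS]big_nat_recl//= lerDr.
Qed.

Lemma bounded_series_cvg g (G : R) : (forall k, 0 <= g k) ->
  (forall N, \sum_(0 <= k < N) g k <= G) ->
  [/\ series g @ \oo --> limn (series g), g @ \oo --> 0,
      forall N, series g N <= limn (series g) & limn (series g) <= G].
Proof.
move=> g0 gG.
have nd : nondecreasing_seq (series g).
  by apply/nondecreasing_seqP => k; rewrite /series/= big_nat_recr//= lerDl.
have cv : cvgn (series g).
  by apply: nondecreasing_is_cvgn nd _; exists G => _ [N _ <-]; exact: gG.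
split => //; first exact: cvg_series_cvg_0.
  exact: nondecreasing_cvgn_le.
by apply: limr_le cv _; apply: nearW.
Qed.

(** A nonincreasing weight can be taken out of the telescoping sum at its first value. The weight is
    the radius for the values b_k and 1 for the coordinates of the slopes. *)
Lemma summable_increments_cvg x g r (S : R) :
  (forall k, 0 <= g k) -> series g @ \oo --> S ->
  (forall N, series g N <= S) -> (forall k, 0 <= r k) ->
  (forall k, r k.+1 <= r k) ->
  (forall k, `|x k - x k.+1| <= r k * g k) ->
  exists l, forall k, `|x k - l| <= r k * (S - series g k).
Proof.
move=> g0 gS leS r0 rS step.
have rmono k j : r (k + j)%N <= r k.
  by elim: j => [|j IH]; rewrite ?addn0// addnS (le_trans (rS _)).
have tele k j : `|x k - x (k + j)%N| <= r k * (series g (k + j)%N - series g k).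
  elim: j => [|j IH]; first by rewrite addn0 !subrr normr0 mulr0.
  rewrite addnS (le_trans (ler_distD (x (k + j)%N) _ _))//.
  have -> : series g (k + j).+1 = series g (k + j)%N + g (k + j)%N.
    by rewrite /series/= big_nat_recr.
  rewrite addrAC mulrDr lerD//.
  by rewrite (le_trans (step _))// ler_wpM2r.
have ser0 : series g 0%N = 0 by rewrite /series/= big_geq.
(* Adding this multiple of the partial sums makes the sequence nondecreasing and keeps it bounded,
   so monotone convergence applies. *)
pose y k := x k + r 0%N * series g k.
have cy : cvgn y.
  apply: nondecreasing_is_cvgn.
    apply/nondecreasing_seqP => k.
    have gk : r k * g k <= r 0%N * g k by rewrite ler_wpM2r//; exact: (rmono 0%N).
    have := le_trans (ler_norm _) (le_trans (step k) gk).
    by rewrite /y /series/= big_nat_recr//= mulrDr; lra.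
  exists (x 0%N + 2 * (r 0%N * S)) => _ [k _ <-].
  have := tele 0%N k; rewrite add0n ser0 subr0 distrC => /(le_trans (ler_norm _)).
  by rewrite /y; have := ler_wpM2l (r0 0%N) (leS k); lra.
have cx : x @ \oo --> limn y - r 0%N * S.
  have -> : x = (fun k => y k - r 0%N * series g k).
    by apply/funext => k; rewrite /y addrK.
  by apply: cvgB => //; apply: cvgMr.
exists (limn y - r 0%N * S) => k.
have cxk : `|x k - x (j + k)%N| @[j --> \oo] --> `|x k - (limn y - r 0%N * S)|.
  apply: cvg_norm; apply: cvgB; first exact: cvg_cst.
  by rewrite cvg_shiftn.
apply: (cvgr_to_le cxk); apply: nearW => j.
rewrite addnC (le_trans (tele k j))// ler_wpM2l// lerD2r.
exact: leS.
Qed.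

End sequences_of_reals.

(** * Epsilon bounds for extended-real limits at zero *)

Section limits_to_zero.
Context (R : realType) (T : Type) (F : set_system T).

Lemma cvge0_le (FF : Filter F) (f : T -> \bar R) : f @ F --> 0%E ->
  forall eps : R, 0 < eps -> \forall x \near F, (f x <= eps%:E)%E.
Proof.
move=> /fine_cvgP[ffin f0] eps eps0.
have fle := cvgr0_norm_le (FF := FF) _ f0 _ eps0.
apply: filterS (filterI ffin fle) => x [xfin /(le_trans (ler_norm _))].
by rewrite -lee_fin fineK.
Qed.

Lemma le_cvge0 (FF : Filter F) (f : T -> \bar R) :
  (\forall x \near F, 0 <= f x)%E ->
  (forall eps : R, 0 < eps -> \forall x \near F, (f x <= eps%:E)%E) ->
  f @ F --> 0%E.
Proof.
move=> f0 fle; apply/fine_cvgP; split.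
  apply: filterS (filterI f0 (fle 1 ltr01)) => x [fx0 fx1].
  by rewrite ge0_fin_numE// (le_lt_trans fx1)// ltry.
apply/cvgr0Pnorm_le => eps eps0; apply: filterS (filterI f0 (fle eps eps0)) => x [fx0 fxe].
rewrite /= ger0_norm ?fine_ge0// -lee_fin fineK//.
by rewrite ge0_fin_numE// (le_lt_trans fxe)// ltry.
Qed.

End limits_to_zero.

(** * Uniqueness of the limit plane and passage from geometric radii to all radii *)

Section affine_limits.
Context (R : realType) (n : nat) (m : R) (u : 'rV[R]_n -> R) (x0 : 'rV[R]_n).
Hypotheses (n0 : (0 < n)%N) (m0 : 0 < m) (mu : measurable_fun setT u).

(** Both averages are small at a common radius r < 1; dividing [affine_diff] by r bounds the slopes,
    and r < 1 then bounds the values. *)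
Lemma affine_limit_unique ba ba' :
  affine_limit m u x0 ba -> affine_limit m u x0 ba' -> ba = ba'.
Proof.
case: ba => b a; case: ba' => b' a' H H'.
have small eps : 0 < eps ->
    `|b - b'| <= eps /\ l1norm (a - a') <= eps.
  move=> eps0; pose K := 2 * Kaff n m + 1.
  have Ka0 : 0 <= Kaff n m by exact: Kaff_ge0.
  have K0 : 0 < K by rewrite /K; lra.
  have e0 : 0 < eps / K by rewrite divr_gt0.
  have pF : ProperFilter (0 : R)^'+ by exact: _.
  have fF : Filter (0 : R)^'+ by exact: _.
  have near0 := @filterI _ _ fF _ _ (nbhs_right_gt (0 : R)) (nbhs_right_lt ltr01).
  have nearl := @filterI _ _ fF _ _ (cvge0_le fF H e0) (cvge0_le fF H' e0).
  have [r [[r0 r1] [Hr H'r]]] := @filter_ex _ _ pF _ (@filterI _ _ fF _ _ near0 nearl).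
  rewrite lee_pdivrMl// -EFinM in Hr; rewrite lee_pdivrMl// -EFinM in H'r.
  have re0 : 0 <= r * (eps / K) by rewrite mulr_ge0// ltW.
  have := affine_diff n0 m0 mu r0 re0 re0 Hr H'r.
  set N := l1norm (a - a'); have N0 : 0 <= N by exact: l1norm_ge0.
  have -> : Kaff n m * (r * (eps / K) + r * (eps / K)) = r * (eps * (2 * Kaff n m / K)).
    by ring.
  have le1 : eps * (2 * Kaff n m / K) <= eps.
    by rewrite ler_piMr ?(ltW eps0)// ler_pdivrMr// mul1r /K; lra.
  move=> le; split.
    apply: (@le_trans _ _ (r * (eps * (2 * Kaff n m / K)))).
      by apply: le_trans le; rewrite lerDl mulr_ge0// ltW.
    apply: le_trans (ler_wpM2l (ltW r0) le1) _.
    by rewrite ler_piMl// ltW.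
  apply: le_trans le1; rewrite -(ler_pM2l r0); apply: le_trans le.
  by rewrite lerDr.
have zero (z : R) : 0 <= z -> (forall eps, 0 < eps -> z <= eps) -> z = 0.
  move=> z0 zle; apply/eqP; rewrite eq_le z0 andbT.
  by apply/ler_addgt0Pl => e /zle; rewrite addr0.
congr pair; apply/eqP; rewrite -subr_eq0.
  rewrite -normr_eq0; apply/eqP/zero => // eps /small[]//.
apply/eqP/l1norm_eq0/zero; first exact: l1norm_ge0.
by move=> eps /small[].
Qed.

Lemma affine_limit_geometric (rho theta b : R) (a : 'rV[R]_n) (eta : nat -> R) :
  0 < rho -> 0 < theta < 1 -> (forall k, 0 <= eta k) -> eta @ \oo --> 0 ->
  (forall k, (Lmean m (fun x => (u x - affine x0 a b x)%R)
     (eball x0 (rho * theta ^+ k)) <= (rho * theta ^+ k * eta k)%:E)%E) ->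
  affine_limit m u x0 (b, a).
Proof.
move=> rho0 /andP[th0 th1] eta0 etacv H.
pose r k := rho * theta ^+ k; have r0 k : 0 < r k by rewrite mulr_gt0 ?exprn_gt0.
have rcv : r @ \oo --> 0.
  rewrite -[X in _ --> X](mulr0 rho); apply: cvgMr; apply: cvg_expr.
  by rewrite ger0_norm// ltW.
have rmono j k : (j <= k)%N -> r k <= r j.
  by move=> jk; rewrite ler_pM2l// ler_wiXn2l// ltW.
pose K := Kshrink n m theta^-1 / theta + 1.
have Ks0 : 0 <= Kshrink n m theta^-1 by exact: powR_ge0.
have K0 : 0 < K by rewrite ltr_wpDl// divr_ge0// ltW.
apply: le_cvge0.
  near=> t; rewrite mule_ge0 ?Lmean_ge0// lee_fin invr_ge0 ltW//.
move=> eps eps0.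
have [N _ Neta] := cvgr0_norm_le _ etacv _ (divr_gt0 eps0 K0).
near=> t.
have t0 : 0 < t by near: t; exact: nbhs_right_gt.
have tN : t <= r N by near: t; exact: nbhs_right_le.
have ex : exists k, r k < t.
  have [M _ Mr] := cvgr0_norm_lt _ rcv _ t0.
  by exists M; apply: le_lt_trans (ler_norm _) (Mr M _) => /=.
(* The least index with radius below t is some k+1, so t lies in (r_{k+1}, r_k]; index 0 is excluded
   by t <= r_N <= r_0. *)
have := ex_minnP ex; case=> [[|k]] rk kmin.
  by have := lt_le_trans rk tN; rewrite ltNge rmono.
have tk : t <= r k by rewrite leNgt; apply/negP => /kmin; rewrite ltnn.
have Nk : (N <= k)%N.
  rewrite leqNgt; apply/negP => /rmono rkN.
  by have := lt_le_trans rk tN; rewrite ltNge rkN.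
have rkt : r k <= theta^-1 * t.
  rewrite mulrC ler_pdivlMr// (_ : r k * theta = r k.+1) ?ltW//.
  by rewrite /r exprSr mulrA.
have c0 : 0 <= r k * eta k by rewrite mulr_ge0// ltW.
have := Lmean_shrink n0 m0 (measurable_affineB x0 a b mu) t0 tk rkt c0 (H k).
move=> Ht.
rewrite lee_pdivrMl//; apply: le_trans Ht _; rewrite -EFinM lee_fin.
have etak : eta k <= eps / K by apply: le_trans (ler_norm _) (Neta k Nk).
apply: (@le_trans _ _ (Kshrink n m theta^-1 * (theta^-1 * t * (eps / K)))).
  by rewrite ler_wpM2l// ler_pM// ltW.
have -> : Kshrink n m theta^-1 * (theta^-1 * t * (eps / K)) =
    t * (eps * (Kshrink n m theta^-1 / theta / K)) by ring.
rewrite ler_pM2l// ler_piMr ?(ltW eps0)// ler_pdivrMr// mul1r /K lerDl.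
exact: ler01.
Unshelve. all: by end_near. Qed.

End affine_limits.

(** * Convergence of the approximating planes *)

Section approximating_planes.
Context (R : realType) (n : nat) (m : R) (u : 'rV[R]_n -> R) (x0 : 'rV[R]_n).
Hypotheses (n0 : (0 < n)%N) (m0 : 0 < m) (mu : measurable_fun setT u).

(** [Kshrink] moves the first plane to the smaller ball, 1 accounts for the second plane, and the
    outer inverse of theta comes from dividing by the smaller radius. *)
Definition Kstep (theta : R) : R :=
  theta^-1 * (Kaff n m * (Kshrink n m theta^-1 + 1)).

Lemma Kstep_ge0 theta : 0 <= theta -> 0 <= Kstep theta.
Proof.
move=> th0; rewrite mulr_ge0 ?invr_ge0// mulr_ge0 ?Kaff_ge0//.
by rewrite addr_ge0 ?powR_ge0.
Qed.

Lemma planes_step (r theta e e' b b' : R) (a a' : 'rV[R]_n) :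
  0 < r -> 0 < theta < 1 -> 0 <= e -> 0 <= e' ->
  (Lmean m (fun x => (u x - affine x0 a b x)%R) (eball x0 r) <= (r * e)%:E)%E ->
  (Lmean m (fun x => (u x - affine x0 a' b' x)%R) (eball x0 (r * theta)) <=
    (r * theta * e')%:E)%E ->
  `|b - b'| <= r * (Kstep theta * (e + e')) /\
  l1norm (a - a') <= Kstep theta * (e + e').
Proof.
move=> r0 /andP[th0 th1] e0 e'0 H H'.
have rt0 : 0 < r * theta by rewrite mulr_gt0.
have rtr : r * theta <= r by rewrite ler_piMr// ltW.
have rM : r <= theta^-1 * (r * theta) by rewrite mulrCA mulVf ?gt_eqF// mulr1.
have c0 : 0 <= r * e by rewrite mulr_ge0// ltW.
have Ks0 : 0 <= Kshrink n m theta^-1 by exact: powR_ge0.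
have Hs := Lmean_shrink n0 m0 (measurable_affineB x0 a b mu) rt0 rtr rM c0 H.
have Ksc : 0 <= Kshrink n m theta^-1 * (r * e) by rewrite mulr_ge0.
have rte : 0 <= r * theta * e' by rewrite mulr_ge0// ltW.
have := affine_diff n0 m0 mu rt0 Ksc rte Hs H'.
set B := `|b - b'|; set A := l1norm (a - a').
have B0 : 0 <= B by exact: normr_ge0.
have A0 : 0 <= A by exact: l1norm_ge0.
have Ka0 : 0 <= Kaff n m by exact: Kaff_ge0.
pose Q := Kaff n m * ((Kshrink n m theta^-1 + 1) * (e + e')).
have Q0 : 0 <= Q by rewrite !mulr_ge0// addr_ge0.
have le1 : Kaff n m * (Kshrink n m theta^-1 * (r * e) + r * theta * e') <= r * Q.
  rewrite /Q [leRHS]mulrCA ler_wpM2l// mulrCA mulrDl mul1r.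
  rewrite -mulrA -mulrDr ler_wpM2l ?(ltW r0)//; apply: lerD.
    by rewrite ler_wpM2l// lerDl.
  by apply: (@le_trans _ _ e'); [rewrite ler_piMl// ltW|rewrite lerDr].
have KQ : Kstep theta * (e + e') = theta^-1 * Q by rewrite /Kstep /Q; ring.
rewrite KQ => /le_trans/(_ le1) le2; split.
  apply: (@le_trans _ _ (r * Q)).
    by apply: le_trans le2; rewrite lerDl mulr_ge0// ltW.
  by rewrite ler_wpM2l ?(ltW r0)// ler_peMl// invf_ge1// ltW.
rewrite ler_pdivlMl// -(ler_pM2l r0) mulrA.
by apply: le_trans le2; rewrite lerDr.
Qed.

(** A single error [eps], n times the tail of the increment series, serves slopes and values; the
    factor n comes from summing coordinates. Its uniform bound later gives the estimate for all
    slopes. *)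
Lemma planes_converge (rho theta X : R) (a : nat -> 'rV[R]_n) (b e : nat -> R) :
  0 < rho -> 0 < theta < 1 -> (forall k, 0 <= e k) ->
  (forall k, (Lmean m (fun x => (u x - affine x0 (a k) (b k) x)%R)
     (eball x0 (rho * theta ^+ k)) <= (rho * theta ^+ k * e k)%:E)%E) ->
  (forall N, \sum_(0 <= k < N) e k <= X) ->
  exists b' a' (eps : nat -> R),
    [/\ affine_limit m u x0 (b', a'), e @ \oo --> 0, eps @ \oo --> 0,
        forall k, 0 <= eps k <= n%:R * (Kstep theta * (2 * X)) &
        forall k, l1norm (a k - a') <= eps k /\
          `|b k - b'| <= rho * theta ^+ k * eps k].
Proof.
move=> rho0 th e0 H sumX; have /andP[th0 th1] := th.
pose r k := rho * theta ^+ k; have r0 k : 0 < r k by rewrite mulr_gt0 ?exprn_gt0.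
have rS k : r k.+1 = r k * theta by rewrite /r exprSr mulrA.
have rdec k : r k.+1 <= r k by rewrite rS ler_piMr// ltW.
pose g k := Kstep theta * (e k + e k.+1).
have Kst0 : 0 <= Kstep theta by rewrite Kstep_ge0// ltW.
have g0 k : 0 <= g k by rewrite mulr_ge0// addr_ge0.
have step k : `|b k - b k.+1| <= r k * g k /\ l1norm (a k - a k.+1) <= g k.
  by apply: planes_step => //; rewrite -rS; exact: H.
have gX N : \sum_(0 <= k < N) g k <= Kstep theta * (2 * X).
  rewrite -mulr_sumr ler_wpM2l// (le_trans (sum_succ_le _ e0))//.
  by rewrite ler_wpM2l.
have [gS _ leS SX] := bounded_series_cvg g0 gX.
have [_ ecv _ _] := bounded_series_cvg e0 sumX.
set S := limn (series g) in gS leS SX.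
have [b' Hb] : exists l, forall k, `|b k - l| <= r k * (S - series g k).
  by apply: summable_increments_cvg => // k; [exact: ltW|have [] := step k].
have Ha i : exists l, forall k, `|a k 0 i - l| <= 1 * (S - series g k).
  apply: (@summable_increments_cvg _ _ g (fun=> 1)) => // k.
  rewrite mul1r; apply: le_trans (step k).2.
  rewrite /l1norm (bigD1 i)//= !mxE lerDl.
  exact: sumr_ge0.
have [a'' Ha'] := choice Ha.
pose a' := \row_i a'' i; pose eps k := n%:R * (S - series g k).
have Sg0 k : 0 <= S - series g k by rewrite subr_ge0.
have n1 : 1 <= n%:R :> R by rewrite ler1n.
have eps0 k : 0 <= eps k by rewrite mulr_ge0.
have cveps : eps @ \oo --> 0.
  rewrite -[X in _ --> X](mulr0 n%:R) -(subrr S); apply: cvgMr.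
  by apply: cvgB => //; exact: cvg_cst.
have l1eps k : l1norm (a k - a') <= eps k.
  rewrite /eps -[X in X%:R * _]card_ord mulr_natl -sumr_const.
  by apply: ler_sum => i _; rewrite !mxE -[leRHS]mul1r.
have beps k : `|b k - b'| <= r k * eps k.
  rewrite (le_trans (Hb k))// ler_wpM2l ?(ltW (r0 k))//.
  by rewrite ler_peMl.
have ser_ge0 k : 0 <= series g k by rewrite /series/= sumr_ge0.
exists b', a', eps; split => //; last first.
  move=> k; rewrite eps0/= ler_wpM2l//; apply: le_trans SX.
  by rewrite lerBlDr lerDl.
pose K := (2 `^ m * 2) `^ m^-1; have K0 : 0 <= K by exact: powR_ge0.
(* The distance of the k-th plane to the limit plane on the ball is at most 2 r_k eps_k: one share
   from the values, one from the slopes. *)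
apply: (@affine_limit_geometric _ _ _ _ _ n0 m0 mu rho theta b' a'
  (fun k => K * (e k + 2 * eps k))) => //.
- by move=> k; rewrite mulr_ge0// addr_ge0// mulr_ge0.
- rewrite -[X in _ --> X](mulr0 K); apply: cvgMr.
  rewrite -[X in _ --> X](addr0 0); apply: cvgD => //.
  by rewrite -[X in _ --> X](mulr0 2); apply: cvgMr.
move=> k; rewrite -/(r k).
have re0 : 0 <= r k * e k by rewrite mulr_ge0// ltW.
have reps0 : 0 <= 2 * (r k * eps k) by rewrite mulr_ge0// mulr_ge0// ltW.
have := Lmean_perturb n0 m0 (measurable_affineB x0 (a k) (b k) mu)
  (measurable_affineB x0 a' b' mu) (r0 k) re0 reps0 _ (H k).
rewrite -/K (_ : K * (_ + _) = r k * (K * (e k + 2 * eps k))); last by ring.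
apply => y /ltW yr.
rewrite opprB [X in `|X|]addrC addrA subrK affineB.
rewrite (le_trans (ler_normD _ _))// mulr_natl mulr2n lerD//.
rewrite (le_trans (ler_dot_l1norm _ _))// mulrC ler_pM ?enorm_ge0 ?l1norm_ge0//.
Qed.

End approximating_planes.

(** * Finiteness of the affine excess of a SOLA *)

Section SOLA.
Context (R : realType) (n : nat) (s p : R).
Hypotheses (n0 : (0 < n)%N) (p1 : 1 < p) (s0 : 0 < s).

Let m0 : 0 < p - 1. Proof. by rewrite subr_gt0. Qed.
Let t0 : 0 < s * p. Proof. by rewrite mulr_gt0// (lt_trans _ p1). Qed.

Lemma Psi_ge0 m t (u : 'rV[R]_n -> R) x0 r : 0 < r -> (0 <= Psi m t u x0 r)%E.
Proof.
move=> r0; apply: le_ereal_inf_tmp => _ [ab _ <-].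
exact: excess_ge0.
Qed.

Lemma Psi_le m t (u : 'rV[R]_n -> R) x0 r a b :
  (Psi m t u x0 r <= affine_excess m t u x0 r a b)%E.
Proof. by apply: ereal_inf_lbound; exists (a, b). Qed.

Lemma affine0 (x0 : 'rV[R]_n) (b : R) : affine x0 0 b = (fun=> b).
Proof.
apply/funext => y; rewrite /affine /dot big1 ?addr0// => i _.
by rewrite mxE mul0r.
Qed.

(** The zero function is a competitor, and its excess is finite because the exponent q of the SOLA
    is at least p - 1. *)
Lemma SOLA_Psi_lty (U : set 'rV[R]_n) mu u x0 r : open U -> bounded_set U ->
  is_SOLA s p U mu u -> 0 < r -> (Psi (p - 1) (s * p) u x0 r < +oo)%E.
Proof.
move=> oU bU [mu_u zu [h [q [_ /andP[mq _] [_ uq _] _ _]]]] r0.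
apply: le_lt_trans (Psi_le _ _ _ _ _ 0 0) _.
rewrite /affine_excess affine0.
rewrite (_ : (fun x => _) = u); last by apply/funext => x; rewrite subr0.
apply: (excess_lty n0 t0 x0 mu_u r0).
exact: (lty_integral_powR m0 mq oU bU mu_u zu uq).
Qed.

Lemma compactly_contained_sub (T : topologicalType) (A B U : set T) :
  A `<=` B -> compactly_contained B U -> compactly_contained A U.
Proof.
move=> AB [cB BU]; have cAB := closureS AB; split; last exact: subset_trans BU.
by apply: subclosed_compact cB cAB; exact: closed_closure.
Qed.

End SOLA.

(** * Choice of the constant and proof of the three conclusions *)

Unset Implicit Arguments.

Theorem lemma5p3 (R : realType) (n : nat) (p s theta C0 : R)
    (hn : (2 <= n)%N) (hp : 2 < p) (hs0 : 0 < s) (hs1 : s < 1)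
    (hsp : p - 1 < s * p)
    (htheta0 : 0 < theta) (htheta : theta < 512^-1) (hC0 : 1 <= C0)
    (hdecay : excess_decay n s p theta C0) :
  exists2 C : R, 0 < C &
  forall (Omega : set 'rV[R]_n) (mu : {charge set 'rV[R]_n -> \bar R})
    (u : 'rV[R]_n -> R) (x0 : 'rV[R]_n) (rho : R)
    (a : nat -> 'rV[R]_n) (b : nat -> R),
  let r := fun k : nat => rho / 2 * theta ^+ k in
  let E := fun k : nat => Psi (p - 1) (s * p) u x0 (r k) in
  let D := fun k : nat => D_mu s p mu x0 (2 * r k) in
  open Omega -> bounded_set Omega -> extended_by_zero Omega mu ->
  is_SOLA s p Omega mu u ->
  0 < rho -> compactly_contained (eball x0 (2 * rho)) Omega ->
  (wolff s p mu x0 (2 * rho) < +oo)%E ->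
  (forall k, affine_excess (p - 1) (s * p) u x0 (r k) (a k) (b k) = E k) ->
  exists (b' : R) (a' : 'rV[R]_n),
    [/\ unique (affine_limit (p - 1) u x0) (b', a'),
        (E k + D k + (enorm (a k - a'))%:E + (`|b k - b'| / r k)%:E)%E
          @[k --> \oo] --> 0%E &
        ((enorm a')%:E + ereal_sup [set (enorm (a k))%:E | k in [set: nat]] +
           \sum_(0 <= k <oo) E k <=
         C%:E * (A_m (p - 1) (s * p) u x0 (2 * rho) +
                 wolff s p mu x0 (2 * rho)))%E].
Proof.
have n0 : (0 < n)%N by exact: leq_trans hn.
have m0 : 0 < p - 1 by lra.
have p1 : 1 < p by lra.
have t0 : 0 < s * p by rewrite mulr_gt0//; lra.
have nu0 : 0 <= n%:R - (s * p - p + 1).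
  have n2 : 2 <= n%:R :> R by rewrite ler_nat.
  have : s * p <= p by rewrite ler_piMl//; lra.
  lra.
have th : 0 < theta < 1 by rewrite htheta0/=; lra.
pose Ka := Kaff n (p - 1); have Ka0 : 0 <= Ka by exact: Kaff_ge0.
pose Kq := Kquarter n (p - 1); have Kq0 : 0 <= Kq by exact: Kquarter_ge0.
pose Kd := KD n s p; have Kd0 : 0 < Kd by exact: KD_gt0.
(* [Kg * X] will bound every [eps k], where X bounds the sum of the excesses; [Kx] bounds X itself,
   from X = 2 (E_0 + 2 C0 Kd W) and E_0 <= Kq A. *)
pose Kg := n%:R * (Kstep n (p - 1) theta * 2).
have Kg0 : 0 <= Kg by apply: mulr_ge0 => //; apply: mulr_ge0 => //; exact/Kstep_ge0/ltW.
pose Kx := 2 * Kq + 4 * C0 * Kd.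
have C00 : 0 <= C0 by lra.
have Kx0 : 0 <= Kx.
  apply: addr_ge0; first exact: mulr_ge0.
  by apply: mulr_ge0 (ltW Kd0); exact: mulr_ge0.
have C1 : 0 < 4 * Ka * Kq + (3 * Kg + 1) * Kx + 1.
  apply: ltr_wpDl => //; apply: addr_ge0; apply: mulr_ge0 => //.
    exact: mulr_ge0.
  by apply: addr_ge0 => //; exact: mulr_ge0.
(* The left-hand side is at most 2|a_0| + 3 Kg X + X in the l1 norm, and |a_0| is at most 2 Ka Kq A.
   The final 1 ensures positivity. *)
exists (4 * Ka * Kq + (3 * Kg + 1) * Kx + 1) => //.
move=> Omega mu u x0 rho a b r E D oO bO emu sola rho0 cO Wlty aE.
have mu_u : measurable_fun setT u by case: sola.
have r0 k : 0 < r k by rewrite mulr_gt0 ?exprn_gt0// divr_gt0.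
have r_le k : r k <= rho.
  have : theta ^+ k <= 1 by rewrite exprn_ile1//; lra.
  by rewrite -(ler_pM2l (divr_gt0 rho0 (ltr0Sn R 1))) mulr1 => /le_trans; apply; lra.
have E0 k : (0 <= E k)%E by exact: Psi_ge0.
have Efin k : E k \is a fin_num.
  by rewrite ge0_fin_numE//; exact: SOLA_Psi_lty oO bO sola _.
have D0 k : (0 <= D k)%E by exact: D_mu_ge0.
pose W := fine (wolff s p mu x0 (2 * rho)).
have W0 : (0 <= wolff s p mu x0 (2 * rho))%E.
  apply: integral_ge0 => y; rewrite /= in_itv/= => /andP[y0 _].
  by rewrite mule_ge0 ?D_mu_ge0// lee_fin invr_ge0 ltW.
have WE : wolff s p mu x0 (2 * rho) = W%:E by rewrite fineK// ge0_fin_numE.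
have W0' : 0 <= W by rewrite fine_ge0.
have sumDe N : (\sum_(0 <= k < N) D k <= (2 * Kd * W)%:E)%E.
  by rewrite EFinM -WE; apply: sum_D_mu_le => //; lra.
have Dfin k : D k \is a fin_num.
  rewrite ge0_fin_numE//; apply: le_lt_trans (ltry (2 * Kd * W)).
  apply: le_trans (sumDe k.+1); rewrite big_nat_recr//= leeDr//.
  exact: sume_ge0.
pose e k := fine (E k); pose d k := fine (D k).
have Ee k : E k = (e k)%:E by rewrite fineK.
have Dd k : D k = (d k)%:E by rewrite fineK.
have e0 k : 0 <= e k by rewrite fine_ge0.
have d0 k : 0 <= d k by rewrite fine_ge0.
have sumD N : \sum_(0 <= k < N) d k <= 2 * Kd * W.
  rewrite -lee_fin -sumEFin; apply: le_trans (sumDe N).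
  by under [leRHS]eq_bigr do rewrite Dd.
have decay k : e k.+1 <= 2^-1 * e k + C0 * d k.
  rewrite -lee_fin EFinD (EFinM 2^-1) (EFinM C0) -!Ee -Dd /E.
  have -> : r k.+1 = theta * r k by rewrite /r exprS; ring.
  apply: (hdecay Omega) => //.
  (* The decay hypothesis asks for the ball of radius 2 r_k inside Omega, and r_k <= rho. *)
  apply: (compactly_contained_sub _ cO); apply: subset_eball.
  by rewrite ler_pM2l.
pose X := 2 * (e 0%N + C0 * (2 * Kd * W)).
have sumE N : \sum_(0 <= k < N) e k <= X.
  rewrite (le_trans (halving_sum_le e0 decay N))// ler_wpM2l// lerD2l.
  by rewrite ler_wpM2l.
have L k : (Lmean (p - 1) (fun x => (u x - affine x0 (a k) (b k) x)%R)
    (eball x0 (r k)) <= (r k * e k)%:E)%E.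
  apply: (@excess_le_Lmean _ _ _ (s * p)) => //.
  by rewrite -Ee -aE.
have rho20 : 0 < rho / 2 by rewrite divr_gt0.
have [b' [a' [eps [lim ecv epscv epsX close]]]] :=
  planes_converge n0 m0 mu_u rho20 th e0 L sumE.
exists b', a'; split.
- split => // ba; exact: affine_limit_unique.
- have [_ dcv _ _] := bounded_series_cvg d0 sumD.
  have -> : (fun k => E k + D k + (enorm (a k - a'))%:E + (`|b k - b'| / r k)%:E)%E =
      EFin \o (fun k => e k + d k + enorm (a k - a') + `|b k - b'| / r k).
    by apply/funext => k /=; rewrite Ee Dd.
  apply: cvg_EFin; first by apply: nearW.
  rewrite -[X in _ --> X](addr0 0); apply: cvgD; last first.
    apply: (@squeeze_cvgr _ _ _ _ (fun=> 0) eps) => //; last exact: cvg_cst.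
    apply: nearW => k; have [_ bk] := close k.
    by rewrite divr_ge0 ?(ltW (r0 k))//= ler_pdivrMr// mulrC.
  rewrite -[X in _ --> X](addr0 0); apply: cvgD; last first.
    apply: (@squeeze_cvgr _ _ _ _ (fun=> 0) eps) => //; last exact: cvg_cst.
    apply: nearW => k; have [ak _] := close k.
    by rewrite enorm_ge0/= (le_trans (enorm_le_l1norm _)).
  by rewrite -[X in _ --> X](addr0 0); apply: cvgD.
have A0 : (0 <= A_m (p - 1) (s * p) u x0 (2 * rho))%E.
  by apply: excess_ge0; rewrite mulr_gt0.
(* If this excess is infinite, so is the right-hand side, the constant being positive. *)
have [Aoo|Afin] := eqVneq (A_m (p - 1) (s * p) u x0 (2 * rho)) +oo%E.
  by rewrite Aoo WE addye// gt0_muley ?lte_fin// leey.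
have {}Afin : A_m (p - 1) (s * p) u x0 (2 * rho) \is a fin_num.
  by rewrite ge0_fin_numE// ltey.
pose al := fine (A_m (p - 1) (s * p) u x0 (2 * rho)).
have Aal : A_m (p - 1) (s * p) u x0 (2 * rho) = al%:E by rewrite fineK.
have al0 : 0 <= al by rewrite fine_ge0.
have r0E : r 0%N = rho / 2 by rewrite /r expr0 mulr1.
pose c := mean u (eball x0 (2 * rho)).
have exc : (affine_excess (p - 1) (s * p) u x0 (r 0%N) 0 c <= (Kq * al)%:E)%E.
  rewrite r0E /affine_excess affine0; apply: excess_quarter => //.
    exact: measurable_funB.
  by rewrite -Aal.
have e0al : e 0%N <= Kq * al.
  by rewrite -lee_fin -Ee; apply: le_trans exc; exact: Psi_le.
have Lc := excess_le_Lmean (r0 0%N) exc.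
(* The constant [c] has slope 0, so comparing it with the first plane on the ball of radius r_0
   bounds that plane's slope. *)
have a0 : l1norm (a 0%N) <= 2 * Ka * Kq * al.
  have re0 : 0 <= r 0%N * e 0%N by rewrite mulr_ge0// ltW.
  have rq0 : 0 <= r 0%N * (Kq * al) by apply: mulr_ge0 (ltW (r0 _)) _; exact: mulr_ge0.
  have := affine_diff n0 m0 mu_u (r0 0%N) re0 rq0 (L 0%N) Lc.
  rewrite subr0 -/Ka -mulrDr mulrCA => H.
  have : r 0%N * l1norm (a 0%N) <= r 0%N * (Ka * (e 0%N + Kq * al)).
    by apply: le_trans H; rewrite lerDr.
  rewrite ler_pM2l// => /le_trans; apply.
  rewrite (_ : 2 * Ka * Kq * al = Ka * (Kq * al + Kq * al)); last by ring.
  by rewrite ler_wpM2l// lerD2r.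
pose del := Kg * X.
have epsdel k : eps k <= del.
  by have /andP[_ /le_trans] := epsX k; apply; rewrite /del /Kg !mulrA.
have a'le : l1norm a' <= l1norm (a 0%N) + del.
  rewrite -[a'](subrK (a 0%N)) addrC (le_trans (ler_l1normD _ _))// lerD2l.
  rewrite -l1normN opprB (le_trans _ (epsdel 0%N))//.
  by have [] := close 0%N.
have ale k : l1norm (a k) <= l1norm a' + del.
  rewrite -[a k](subrK a') addrC (le_trans (ler_l1normD _ _))// lerD2l.
  by rewrite (le_trans _ (epsdel k))//; have [] := close k.
have sup : (ereal_sup [set (enorm (a k))%:E | k in [set: nat]] <=
    (l1norm a' + del)%:E)%E.
  apply: ge_ereal_sup => _ [k _ <-]; rewrite lee_fin.
  by rewrite (le_trans (enorm_le_l1norm _)).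
have sumoo : (\sum_(0 <= k <oo) E k <= X%:E)%E.
  apply: lime_le; first by apply: is_cvg_nneseries.
  apply: nearW => N; under eq_bigr do rewrite Ee.
  by rewrite sumEFin lee_fin.
rewrite Aal WE -EFinD -EFinM.
apply: (@le_trans _ _ (l1norm a' + (l1norm a' + del) + X)%:E).
  rewrite EFinD (EFinD (l1norm a')); apply: leeD => //; apply: leeD => //.
  by rewrite lee_fin enorm_le_l1norm.
rewrite lee_fin.
have XK : X <= Kx * (al + W).
  rewrite /X /Kx.
  have h1 : 0 <= C0 * Kd * al by apply: mulr_ge0 => //; apply: mulr_ge0 (ltW Kd0).
  have h2 : 0 <= Kq * W by exact: mulr_ge0.
  have -> : (2 * Kq + 4 * C0 * Kd) * (al + W) =
    2 * (Kq * al) + 2 * (Kq * W) + 4 * (C0 * Kd * al) + 4 * (C0 * Kd * W) by ring.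
  have -> : C0 * (2 * Kd * W) = 2 * (C0 * Kd * W) by ring.
  lra.
have KgX : del <= Kg * (Kx * (al + W)) by rewrite ler_wpM2l.
have h3 : 0 <= Ka * Kq * W by apply: mulr_ge0 => //; exact: mulr_ge0.
have aW : 0 <= al + W by rewrite addr_ge0.
have -> : (4 * Ka * Kq + (3 * Kg + 1) * Kx + 1) * (al + W) =
  2 * (2 * Ka * Kq * al) + 4 * (Ka * Kq * W) + 3 * (Kg * (Kx * (al + W)))
  + Kx * (al + W) + (al + W) by ring.
lra.
Qed.
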